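(* Let $\Bbbk$ be a field, $n\geq1$, and let $R$ be a Poisson $\Bbbk$-algebra with trivial bracket. Let $\boldsymbol\partial=(\partial_1,\dots,\partial_n)$ be commuting (Poisson) derivations of $R$, $\mathbf a=(a_1,\dots,a_n)$ regular (Poisson central) elements of $R$, and $\mu_{ij},\gamma_{ij}\in\Bbbk$ scalars with $\partial_j(a_i)=\gamma_{ij}a_i$ and $\gamma_{ij}+\gamma_{ji}=\mu_{ij}+\mu_{ji}$ for all $i\neq j$. Set $p_{ij}=\gamma_{ij}-\mu_{ij}$ for $i\ne j$ and $p_{ii}=0$, and let $S=R_{\mathbf p}[\mathbf t^{\pm1};\boldsymbol\partial]$ be the skew Laurent Poisson algebra. Let $S'$ be the subalgebra of $S$ generated over $R$ by $t_i$ and $a_it_i^{-1}$ for all $i=1,\dots,n$. Then $A_\mu(R,\boldsymbol\partial,\mathbf a)\cong S'$ as Poisson algebras.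
   Context: A Poisson algebra is a commutative $\Bbbk$-algebra with a Lie bracket $\{,\}$ that is a derivation in each argument. Given commuting Poisson derivations $\boldsymbol\partial$ of $R$ and a skew-symmetric matrix $\mathbf p=(p_{ij})\in M_n(\Bbbk)$, $R_{\mathbf p}[\mathbf t^{\pm1};\boldsymbol\partial]$ is the Laurent polynomial ring $R[t_1^{\pm1},\dots,t_n^{\pm1}]$ with the Poisson bracket extending that of $R$ with $\{r,t_i^{\pm1}\}=\pm\partial_i(r)t_i^{\pm1}$ and $\{t_i,t_j^{\pm1}\}=\pm p_{ij}t_it_j^{\pm1}$ for $r\in R$, $i\neq j$. The twisted generalized Weyl Poisson algebra $A_\mu(R,\boldsymbol\partial,\mathbf a)$ of type $(A_1)^n$ is the algebra $R[x_1,y_1,\dots,x_n,y_n]/(y_1x_1-a_1,\dots,y_nx_n-a_n)$ with Poisson bracket extending that of $R$ and given by $\{r,x_i\}=\partial_i(r)x_i$, $\{r,y_i\}=-\partial_i(r)y_i$, $\{y_i,x_i\}=\partial_i(a_i)$ for all $i$ and $r\in R$, and $\{y_i,x_j\}=\mu_{ij}x_jy_i$, $\{x_i,x_j\}=(\gamma_{ij}-\mu_{ij})x_ix_j$, $\{y_i,y_j\}=(\mu_{ji}-\gamma_{ij})y_iy_j$ for $i\ne j$. *)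

(* Defs.v *)
From HB Require Import structures.
From mathcomp Require Import all_boot all_order all_algebra.
From mathcomp Require Import finmap ring.
From mathcomp Require ssrcomplements boolp.
From mathcomp Require Import monalg mpoly.

Set Implicit Arguments.
Unset Strict Implicit.
Unset Printing Implicit Defensive.

Import GRing.Theory.
Local Open Scope ring_scope.

(* monalg and mpoly both define this notation; it always means mpoly here. *)
Local Notation "{ 'mpoly' R [ n ] }" := (mpoly n R) : type_scope.

(* comAlgType algebras are nonzero rings. *)
Record is_poisson_bracket (k : fieldType) (A : comAlgType k)
    (br : A -> A -> A) : Prop := IsPoissonBracket {
  pbracket_linearl : forall (c : k) (f g h : A),
    br (c *: f + g) h = c *: br f h + br g h;
  pbracket_linearr : forall (c : k) (f g h : A),
    br f (c *: g + h) = c *: br f g + br f h;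
  pbracket_alt : forall f : A, br f f = 0;
  pbracket_jacobi : forall f g h : A,
    br f (br g h) + br g (br h f) + br h (br f g) = 0;
  pbracket_leibniz : forall f g h : A, br f (g * h) = br f g * h + g * br f h }.

Record poissonAlg (k : fieldType) := PoissonAlg {
  pcarrier :> comAlgType k;
  pbr : pcarrier -> pcarrier -> pcarrier;
  pbrP : is_poisson_bracket pbr }.

Definition poisson_isomorphic (k : fieldType) (A B : poissonAlg k) : Prop :=
  exists f : {lrmorphism A -> B},
    bijective f /\ forall u v : A, f (pbr u v) = pbr (f u) (f v).

Definition trivial_bracket (k : fieldType) (R : poissonAlg k) : Prop :=
  forall r s : R, pbr r s = 0.

Definition poisson_central (k : fieldType) (R : poissonAlg k) (a : R) : Prop :=
  forall r : R, pbr a r = 0.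

Record poisson_derivation (k : fieldType) (R : poissonAlg k)
    (d : {linear R -> R}) : Prop := PoissonDerivation {
  pderM : forall r s : R, d (r * s) = d r * s + r * d s;
  pder_pbr : forall r s : R, d (pbr r s) = pbr (d r) s + pbr r (d s) }.

Section PoissonTheory.
Variables (k : fieldType) (R : poissonAlg k).
Implicit Types (f g h : R) (c : k).

Lemma pbrDl f g h : pbr (f + g) h = pbr f h + pbr g h.
Proof. by have := pbracket_linearl (pbrP R) 1 f g h; rewrite !scale1r. Qed.

Lemma pbrDr f g h : pbr f (g + h) = pbr f g + pbr f h.
Proof. by have := pbracket_linearr (pbrP R) 1 f g h; rewrite !scale1r. Qed.

Lemma pbr0l f : pbr 0 f = 0.
Proof. by apply: (addrI (pbr 0 f)); rewrite -pbrDl !addr0. Qed.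

Lemma pbr0r f : pbr f 0 = 0.
Proof. by apply: (addrI (pbr f 0)); rewrite -pbrDr !addr0. Qed.

Lemma pbrZl c f g : pbr (c *: f) g = c *: pbr f g.
Proof.
by have := pbracket_linearl (pbrP R) c f 0 g; rewrite pbr0l !addr0.
Qed.

Lemma pbrZr c f g : pbr f (c *: g) = c *: pbr f g.
Proof.
by have := pbracket_linearr (pbrP R) c f g 0; rewrite pbr0r !addr0.
Qed.

Lemma pbrNl f g : pbr (- f) g = - pbr f g.
Proof. by rewrite -scaleN1r pbrZl scaleN1r. Qed.

Lemma pbrNr f g : pbr f (- g) = - pbr f g.
Proof. by rewrite -scaleN1r pbrZr scaleN1r. Qed.

Lemma pbr_alt f : pbr f f = 0.
Proof. exact: pbracket_alt (pbrP R) f. Qed.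

Lemma pbrC f g : pbr f g = - pbr g f.
Proof.
apply/eqP; rewrite -addr_eq0; apply/eqP.
by have := pbr_alt (f + g); rewrite pbrDl !pbrDr !pbr_alt addr0 add0r.
Qed.

Lemma pbrMr f g h : pbr f (g * h) = pbr f g * h + g * pbr f h.
Proof. exact: pbracket_leibniz (pbrP R) f g h. Qed.

Lemma pbrMl f g h : pbr (f * g) h = pbr f h * g + f * pbr g h.
Proof. by rewrite pbrC pbrMr (pbrC h f) (pbrC h g); ring. Qed.

Lemma pbr1r f : pbr f 1 = 0.
Proof.
have := pbrMr f 1 1; rewrite !mulr1 mul1r => e.
by apply: (addrI (pbr f 1)); rewrite -e addr0.
Qed.

Lemma pbr1l f : pbr 1 f = 0.
Proof. by rewrite pbrC pbr1r oppr0. Qed.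

Lemma pbr_jacobi f g h :
  pbr f (pbr g h) + pbr g (pbr h f) + pbr h (pbr f g) = 0.
Proof. exact: pbracket_jacobi (pbrP R) f g h. Qed.

Lemma pder1 (d : {linear R -> R}) : poisson_derivation d -> d 1 = 0.
Proof.
move=> dP; have := pderM dP 1 1; rewrite !mulr1 mul1r => e.
by apply: (addrI (d 1)); rewrite -e addr0.
Qed.

End PoissonTheory.

(* Biadditive extension of
     (r, al), (s, be) |-> (Phi al be r s) t^(al + be)
   to finitely supported functions K -> R. *)
Section LaurentExt.
Variables (K : zmodType) (R : zmodType) (Phi : K -> K -> R -> R -> R).
Local Notation L := {malg R[K]}.

Definition graded_ext (f g : L) : L :=
  \sum_(al <- monalg.msupp f) \sum_(be <- monalg.msupp g)
     << Phi al be (monalg.mcoeff al f) (monalg.mcoeff be g) *g al + be >>.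

Hypothesis PhiDl : forall al be r r' s,
  Phi al be (r + r') s = Phi al be r s + Phi al be r' s.
Hypothesis PhiDr : forall al be r s s',
  Phi al be r (s + s') = Phi al be r s + Phi al be r s'.

Local Lemma Phi0l al be s : Phi al be 0 s = 0.
Proof. by apply: (addrI (Phi al be 0 s)); rewrite -PhiDl !addr0. Qed.
Local Lemma Phi0r al be s : Phi al be s 0 = 0.
Proof. by apply: (addrI (Phi al be s 0)); rewrite -PhiDr !addr0. Qed.

Lemma graded_extE (d1 d2 : {fset K}) f g :
  (monalg.msupp f `<=` d1)%fset -> (monalg.msupp g `<=` d2)%fset ->
  graded_ext f g = \sum_(al <- d1) \sum_(be <- d2)
     << Phi al be (monalg.mcoeff al f) (monalg.mcoeff be g) *g al + be >>.
Proof.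
move=> le1 le2; rewrite /graded_ext.
rewrite [LHS](big_fset_incl _ le1) /=; last first.
  move=> x _ /mcoeff_outdom ->; rewrite big1 // => y _.
  by rewrite Phi0l monalgU0.
apply: eq_bigr => x _; apply: (big_fset_incl _ le2) => y _ /mcoeff_outdom ->.
by rewrite Phi0r monalgU0.
Qed.

Lemma graded_extDl f f' g :
  graded_ext (f + f') g = graded_ext f g + graded_ext f' g.
Proof.
pose d := (monalg.msupp f `|` monalg.msupp f')%fset.
rewrite !(@graded_extE d (monalg.msupp g)) ?msuppD_le ?fsubsetUl ?fsubsetUr //;
  try exact: fsubset_refl; last exact: monalg.msuppD_le.
rewrite -big_split /=; apply: eq_bigr => x _; rewrite -big_split /=.
by apply: eq_bigr => y _; rewrite monalg.mcoeffD PhiDl monalgUD.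
Qed.

Lemma graded_extDr f g g' :
  graded_ext f (g + g') = graded_ext f g + graded_ext f g'.
Proof.
pose d := (monalg.msupp g `|` monalg.msupp g')%fset.
rewrite !(@graded_extE (monalg.msupp f) d) ?fsubsetUl ?fsubsetUr //;
  try exact: fsubset_refl; last exact: monalg.msuppD_le.
rewrite -big_split /=; apply: eq_bigr => x _; rewrite -big_split /=.
by apply: eq_bigr => y _; rewrite monalg.mcoeffD PhiDr monalgUD.
Qed.

Lemma graded_extUU r s al be :
  graded_ext << r *g al >> << s *g be >> = << Phi al be r s *g al + be >>.
Proof.
rewrite (@graded_extE [fset al]%fset [fset be]%fset) ?msuppU_le //.
by rewrite !big_seq_fset1 !mcoeffUU.
Qed.

Lemma laurent_ind (Q : L -> Prop) : Q 0 ->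
  (forall f g, Q f -> Q g -> Q (f + g)) ->
  (forall r al, Q << r *g al >>) -> forall f, Q f.
Proof.
move=> Q0 QD QU f; rewrite [f]monalgE.
by apply: (big_ind Q) => // al _; apply: QU.
Qed.

End LaurentExt.

(* L is additively spanned by the U r al, to be read as r t^al. *)
Section MonomialSpan.
Variables (K R L : zmodType) (U : R -> K -> L).
Hypothesis UD : forall r s al, U (r + s) al = U r al + U s al.
Hypothesis U_ind : forall Q : L -> Prop, Q 0 ->
  (forall f g, Q f -> Q g -> Q (f + g)) -> (forall r al, Q (U r al)) ->
  forall f, Q f.

Lemma span_U0 al : U 0 al = 0.
Proof. by apply: (addrI (U 0 al)); rewrite -UD !addr0. Qed.

Lemma span_trilinear (J : L -> L -> L -> L) :
  (forall f f' g h, J (f + f') g h = J f g h + J f' g h) ->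
  (forall f g g' h, J f (g + g') h = J f g h + J f g' h) ->
  (forall f g h h', J f g (h + h') = J f g h + J f g h') ->
  (forall r s t al be ga, J (U r al) (U s be) (U t ga) = 0) ->
  forall f g h, J f g h = 0.
Proof.
move=> J1 J2 J3 H f g h; elim/U_ind: f => [|f1 f2 e1 e2|r al].
- by apply: (addrI (J 0 g h)); rewrite -J1 !addr0.
- by rewrite J1 e1 e2 addr0.
elim/U_ind: g => [|f1 f2 e1 e2|s be].
- by apply: (addrI (J (U r al) 0 h)); rewrite -J2 !addr0.
- by rewrite J2 e1 e2 addr0.
elim/U_ind: h => [|f1 f2 e1 e2|t ga] //.
- by apply: (addrI (J (U r al) (U s be) 0)); rewrite -J3 !addr0.
- by rewrite J3 e1 e2 addr0.
Qed.

Variables (c : K -> K -> R -> R -> R) (mul : L -> L -> L).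
Hypothesis mulDl : forall f g h, mul (f + g) h = mul f h + mul g h.
Hypothesis mulDr : forall f g h, mul f (g + h) = mul f g + mul f h.
Hypothesis mulUU : forall r s al be,
  mul (U r al) (U s be) = U (c al be r s) (al + be).

Lemma span_mul0l f : mul 0 f = 0.
Proof. by apply: (addrI (mul 0 f)); rewrite -mulDl !addr0. Qed.
Lemma span_mul0r f : mul f 0 = 0.
Proof. by apply: (addrI (mul f 0)); rewrite -mulDr !addr0. Qed.

Lemma span_mulC :
  (forall al be r s, c al be r s = c be al s r) -> commutative mul.
Proof.
move=> H f g; elim/U_ind: f => [|f1 f2 e1 e2|r al].
- by rewrite span_mul0l span_mul0r.
- by rewrite mulDl mulDr e1 e2.
elim/U_ind: g => [|f1 f2 e1 e2|s be].
- by rewrite span_mul0l span_mul0r.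
- by rewrite mulDl mulDr e1 e2.
by rewrite !mulUU H addrC.
Qed.

Lemma span_mulN :
  (forall al be r s, c al be r s + c be al s r = 0) ->
  forall f g, mul f g = - mul g f.
Proof.
move=> H f g; elim/U_ind: f => [|f1 f2 e1 e2|r al].
- by rewrite span_mul0l span_mul0r oppr0.
- by rewrite mulDl mulDr opprD e1 e2.
elim/U_ind: g => [|f1 f2 e1 e2|s be].
- by rewrite span_mul0l span_mul0r oppr0.
- by rewrite mulDl mulDr opprD e1 e2.
apply/eqP; rewrite -addr_eq0 !mulUU [be + al]addrC -UD H.
by rewrite span_U0.
Qed.

Lemma span_alt : (forall f g, mul f g = - mul g f) ->
  (forall al r, c al al r r = 0) -> forall f, mul f f = 0.
Proof.
move=> HN H; elim/U_ind => [|f1 f2 e1 e2|r al]; first exact: span_mul0l.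
  by rewrite mulDl !mulDr e1 e2 add0r addr0 HN addNr.
by rewrite mulUU H span_U0.
Qed.

Lemma span_mulA :
  (forall al be ga r s t, c al (be + ga) r (c be ga s t) =
     c (al + be) ga (c al be r s) t) -> associative mul.
Proof.
move=> H f g h; apply/eqP; rewrite -subr_eq0; apply/eqP.
apply: (span_trilinear
  (J := fun f g h => mul f (mul g h) - mul (mul f g) h)) => {f g h}.
- by move=> *; rewrite !(mulDl, mulDr) opprD addrACA.
- by move=> *; rewrite !(mulDl, mulDr) opprD addrACA.
- by move=> *; rewrite !(mulDl, mulDr) opprD addrACA.
by move=> *; rewrite !mulUU H addrA subrr.
Qed.

Lemma span_mul1l (e : R) :
  (forall al r, c 0 al e r = r) -> left_id (U e 0) mul.
Proof.
move=> H; elim/U_ind => [|f1 f2 e1 e2|t ga]; first exact: span_mul0r.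
  by rewrite mulDr e1 e2.
by rewrite mulUU H add0r.
Qed.

End MonomialSpan.

Section BracketSpan.
Variables (K : zmodType) (R L : comNzRingType) (U : R -> K -> L).
Hypothesis UD : forall r s al, U (r + s) al = U r al + U s al.
Hypothesis UM : forall r s al be, U r al * U s be = U (r * s) (al + be).
Hypothesis U_ind : forall Q : L -> Prop, Q 0 ->
  (forall f g, Q f -> Q g -> Q (f + g)) -> (forall r al, Q (U r al)) ->
  forall f, Q f.

Lemma span_scaleA r s f : U r 0 * (U s 0 * f) = U (r * s) 0 * f.
Proof. by rewrite mulrA UM addr0. Qed.

Variables (c : K -> K -> R -> R -> R) (br : L -> L -> L).
Hypothesis brDl : forall f g h, br (f + g) h = br f h + br g h.
Hypothesis brDr : forall f g h, br f (g + h) = br f g + br f h.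
Hypothesis brUU : forall r s al be,
  br (U r al) (U s be) = U (c al be r s) (al + be).

Lemma span_leibniz :
  (forall al be ga r s t, c al (be + ga) r (s * t) =
     c al be r s * t + s * c al ga r t) ->
  forall f g h, br f (g * h) = br f g * h + g * br f h.
Proof.
move=> H f g h; apply/eqP; rewrite -subr_eq0; apply/eqP.
apply: (span_trilinear U_ind
  (J := fun f g h => br f (g * h) - (br f g * h + g * br f h))) => {f g h}.
- by move=> *; rewrite !(mulrDl, mulrDr, brDl, brDr); ring.
- by move=> *; rewrite !(mulrDl, mulrDr, brDl, brDr); ring.
- by move=> *; rewrite !(mulrDl, mulrDr, brDl, brDr); ring.
move=> r s t al be ga; rewrite !(UM, brUU) H UD.
by rewrite [be + (al + ga)]addrCA addrA subrr.
Qed.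

Lemma span_jacobi :
  (forall al be ga r s t, c al (be + ga) r (c be ga s t) +
     c be (ga + al) s (c ga al t r) + c ga (al + be) t (c al be r s) = 0) ->
  forall f g h, br f (br g h) + br g (br h f) + br h (br f g) = 0.
Proof.
move=> H; apply: (span_trilinear U_ind
  (J := fun f g h => br f (br g h) + br g (br h f) + br h (br f g))) => //.
- by move=> *; rewrite !(brDl, brDr); ring.
- by move=> *; rewrite !(brDl, brDr); ring.
- by move=> *; rewrite !(brDl, brDr); ring.
move=> r s t al be ga; rewrite !brUU.
have -> : be + (ga + al) = al + (be + ga) by rewrite addrA addrC.
have -> : ga + (al + be) = al + (be + ga) by rewrite addrC addrA.
by rewrite -!UD H (span_U0 UD).
Qed.

Lemma span_brZl e : (forall al be r s,
    c al be (e * r) s = e * c al be r s) ->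
  forall f g, br (U e 0 * f) g = U e 0 * br f g.
Proof.
move=> H f g; elim/U_ind: f => [|f1 f2 e1 e2|r al].
- by rewrite mulr0 (span_mul0l brDl) mulr0.
- by rewrite mulrDr !brDl e1 e2 mulrDr.
elim/U_ind: g => [|f1 f2 e1 e2|s be].
- by rewrite !(span_mul0r brDr) mulr0.
- by rewrite !brDr e1 e2 mulrDr.
by rewrite !(UM, brUU) H !add0r.
Qed.

End BracketSpan.

(* Finitely supported functions Z^n -> R, al |-> coefficient of t^al.  The
   product of {malg R[K]} from multinomials is not available: a monomType has
   no nontrivial invertible element, so K = Z^n does not qualify.  The module
   structure put on this type is the one over k, not the one over R. *)
Definition laurent (k : fieldType) (R : comAlgType k) (n : nat) : Type :=
  {malg R['rV[int]_n]}.

Section LaurentRing.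
Variables (k : fieldType) (R : comAlgType k) (n : nat).
Local Notation K := 'rV[int]_n.
Local Notation L := (laurent R n).

HB.instance Definition _ := GRing.Zmodule.copy L {malg R[K]}.

Definition lmon (r : R) (al : K) : L := << r *g al >>.
Definition lcoef (al : K) (f : L) : R := monalg.mcoeff al f.
Definition lsupp (f : L) : seq K := monalg.msupp f.

Definition laurent_one : L := lmon 1 0.

Definition laurent_mul (f g : L) : L :=
  \sum_(al <- lsupp f) \sum_(be <- lsupp g)
     lmon (lcoef al f * lcoef be g) (al + be).

Local Notation mulPhi := (fun (_ _ : K) (r s : R) => r * s).

Lemma lmonD r s al : lmon (r + s) al = lmon r al + lmon s al.
Proof. exact: monalgUD. Qed.

Lemma lmon0 al : lmon 0 al = 0.
Proof. exact: monalgU0. Qed.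

Local Lemma lmulDl : left_distributive laurent_mul +%R.
Proof. by move=> f g h; apply: (graded_extDl (Phi := mulPhi)) => *; ring. Qed.

Local Lemma lmulDr : right_distributive laurent_mul +%R.
Proof. by move=> f g h; apply: (graded_extDr (Phi := mulPhi)) => *; ring. Qed.

Local Lemma lmulUU r s al be :
  laurent_mul (lmon r al) (lmon s be) = lmon (r * s) (al + be).
Proof. by apply: (graded_extUU (Phi := mulPhi)) => *; ring. Qed.

Lemma lmon_ind (Q : L -> Prop) : Q 0 ->
  (forall f g, Q f -> Q g -> Q (f + g)) ->
  (forall r al, Q (lmon r al)) -> forall f, Q f.
Proof. exact: laurent_ind. Qed.

Local Lemma lmulC : commutative laurent_mul.
Proof. by apply: (span_mulC lmon_ind lmulDl lmulDr lmulUU) => *; ring. Qed.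

Local Lemma lmulA : associative laurent_mul.
Proof. by apply: (span_mulA lmon_ind lmulDl lmulDr lmulUU) => *; ring. Qed.

Local Lemma lmul1l : left_id laurent_one laurent_mul.
Proof. by apply: (span_mul1l lmon_ind lmulDr lmulUU) => *; ring. Qed.

Local Lemma laurent1_neq0 : laurent_one != 0.
Proof. by apply/eqP => /eqP; rewrite monalgU_eq0 oner_eq0. Qed.

HB.instance Definition _ := GRing.Zmodule_isComNzRing.Build L
  lmulA lmulC lmul1l lmulDl laurent1_neq0.

Lemma lmonM r s al be : lmon r al * lmon s be = lmon (r * s) (al + be).
Proof. exact: lmulUU. Qed.

Definition laurent_scale (c : k) (f : L) : L := lmon c%:A 0 * f.

Local Lemma lscaleA a b f :
  laurent_scale a (laurent_scale b f) = laurent_scale (a * b) f.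
Proof.
rewrite /laurent_scale -[(a * b)%:A]scalerA -{2}[b%:A]mul1r scalerAl.
exact: (span_scaleA lmonM).
Qed.

Local Lemma lscale1 : left_id 1 laurent_scale.
Proof. by move=> f; rewrite /laurent_scale scale1r; apply: mul1r. Qed.
Local Lemma lscaleDr : right_distributive laurent_scale +%R.
Proof. by move=> a f g; rewrite /laurent_scale mulrDr. Qed.
Local Lemma lscaleDl f : {morph laurent_scale^~ f : a b / a + b}.
Proof. by move=> a b; rewrite /laurent_scale scalerDl lmonD mulrDl. Qed.

HB.instance Definition _ := GRing.Zmodule_isLmodule.Build k L
  lscaleA lscale1 lscaleDr lscaleDl.

Local Lemma lscaleAl c (f g : L) : c *: (f * g) = (c *: f) * g.
Proof. exact: mulrA. Qed.

HB.instance Definition _ := GRing.Lmodule_isLalgebra.Build k L lscaleAl.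
HB.instance Definition _ := GRing.Lalgebra_isComAlgebra.Build k L.

Lemma laurentZE c (f : L) : c *: f = lmon c%:A 0 * f.
Proof. by []. Qed.

End LaurentRing.

Section SkewLaurent.
Variables (k : fieldType) (R : poissonAlg k) (n : nat).
Variables (d : 'I_n -> {linear R -> R}) (p : 'M[k]_n).
Local Notation K := 'rV[int]_n.
Local Notation L := (laurent R n).

(* For al in Z^n, wder al = \sum_i al_i d_i, and wpair is the bilinear form
   \sum_(i, j) p_ij al_i be_j, so that
     {r, t^al} = wder al r t^al   and   {t^al, t^be} = wpair al be t^(al + be);
   expanding by the Leibniz rule,
     {r t^al, s t^be} = skew_coef al be r s t^(al + be).
   The lemmas skew_bracket_CC, _CT, _CTV, _TT and _TTV below give back the
   brackets of the generators. *)
Definition wder (al : K) (r : R) : R := \sum_i d i r *~ al 0 i.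
Definition wpair (al be : K) : k :=
  \sum_i \sum_j p i j *~ (al 0 i * be 0 j).

Definition skew_coef (al be : K) (r s : R) : R :=
  pbr r s + wder be r * s - r * wder al s + wpair al be *: (r * s).

Definition skew_bracket (f g : L) : L :=
  \sum_(al <- lsupp f) \sum_(be <- lsupp g)
     lmon (skew_coef al be (lcoef al f) (lcoef be g)) (al + be).

Lemma wderD al r s : wder al (r + s) = wder al r + wder al s.
Proof.
rewrite /wder -big_split; apply: eq_bigr => i _ /=.
by rewrite raddfD mulrzDl.
Qed.

Lemma wderZ al c r : wder al (c *: r) = c *: wder al r.
Proof.
rewrite /wder scaler_sumr; apply: eq_bigr => i _ /=.
by rewrite linearZ /= scalerMzr.
Qed.

Lemma wderDl al be r : wder (al + be) r = wder al r + wder be r.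
Proof.
rewrite /wder -big_split; apply: eq_bigr => i _ /=.
by rewrite mxE mulrzDr.
Qed.

Lemma wder0l r : wder 0 r = 0.
Proof. by rewrite /wder big1 // => i _; rewrite mxE mulr0z. Qed.

Lemma wpairDl al al' be : wpair (al + al') be = wpair al be + wpair al' be.
Proof.
rewrite /wpair -big_split; apply: eq_bigr => i _ /=.
rewrite -big_split; apply: eq_bigr => j _ /=.
by rewrite mxE mulrDl mulrzDr.
Qed.

Lemma wpairDr al be be' : wpair al (be + be') = wpair al be + wpair al be'.
Proof.
rewrite /wpair -big_split; apply: eq_bigr => i _ /=.
rewrite -big_split; apply: eq_bigr => j _ /=.
by rewrite mxE mulrDr mulrzDr.
Qed.

Lemma wpair0l be : wpair 0 be = 0.
Proof. by apply: (addrI (wpair 0 be)); rewrite -wpairDl !addr0. Qed.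

Lemma wpair0r al : wpair al 0 = 0.
Proof. by apply: (addrI (wpair al 0)); rewrite -wpairDr !addr0. Qed.

Local Lemma skew_coefDl (al be : K) (r r' s : R) :
  skew_coef al be (r + r') s = skew_coef al be r s + skew_coef al be r' s.
Proof. by rewrite /skew_coef pbrDl wderD !mulrDl scalerDr; ring. Qed.

Local Lemma skew_coefDr (al be : K) (r s s' : R) :
  skew_coef al be r (s + s') = skew_coef al be r s + skew_coef al be r s'.
Proof. by rewrite /skew_coef pbrDr wderD !mulrDr scalerDr; ring. Qed.

Lemma skew_bracketDl f g h :
  skew_bracket (f + g) h = skew_bracket f h + skew_bracket g h.
Proof. exact: (graded_extDl skew_coefDl skew_coefDr). Qed.

Lemma skew_bracketDr f g h :
  skew_bracket f (g + h) = skew_bracket f g + skew_bracket f h.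
Proof. exact: (graded_extDr skew_coefDl skew_coefDr). Qed.

Lemma skew_bracketUU r s al be :
  skew_bracket (lmon r al) (lmon s be) =
  lmon (skew_coef al be r s) (al + be).
Proof. exact: (graded_extUU skew_coefDl skew_coefDr). Qed.

Hypothesis dP : forall i, poisson_derivation (d i).
Hypothesis dC : forall i j r, d i (d j r) = d j (d i r).
Hypothesis pC : p^T = - p.
Hypothesis p0 : forall i, p i i = 0.

Lemma wderM al r s : wder al (r * s) = wder al r * s + r * wder al s.
Proof.
rewrite /wder mulr_suml mulr_sumr -big_split; apply: eq_bigr => i _ /=.
by rewrite (pderM (dP i)) mulrzDl mulrzAl mulrzAr.
Qed.

Lemma wder_pbr al r s :
  wder al (pbr r s) = pbr (wder al r) s + pbr r (wder al s).
Proof.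
rewrite /wder.
have -> : pbr (\sum_i d i r *~ al 0 i) s = \sum_i pbr (d i r) s *~ al 0 i.
  elim/big_ind2: _ => [|x1 x2 y1 y2 <- <-|i _]; first exact: pbr0l.
    exact: pbrDl.
  by rewrite -!scaler_int pbrZl.
have -> : pbr r (\sum_i d i s *~ al 0 i) = \sum_i pbr r (d i s) *~ al 0 i.
  elim/big_ind2: _ => [|x1 x2 y1 y2 <- <-|i _]; first exact: pbr0r.
    exact: pbrDr.
  by rewrite -!scaler_int pbrZr.
rewrite -big_split; apply: eq_bigr => i _ /=.
by rewrite (pder_pbr (dP i)) mulrzDl.
Qed.

Lemma wderC al be r : wder al (wder be r) = wder be (wder al r).
Proof.
rewrite /wder.
under eq_bigr do rewrite raddf_sum /= mulrz_suml.
under [RHS]eq_bigr do rewrite raddf_sum /= mulrz_suml.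
rewrite exchange_big /=; apply: eq_bigr => i _; apply: eq_bigr => j _.
by rewrite !raddfMz /= dC -!mulrzA mulrC.
Qed.

Local Lemma pE i j : p i j = - p j i.
Proof. by have /matrixP/(_ j i) := pC; rewrite !mxE. Qed.

Lemma wpairC al be : wpair al be = - wpair be al.
Proof.
rewrite /wpair exchange_big -sumrN; apply: eq_bigr => i _ /=.
by rewrite -sumrN; apply: eq_bigr => j _; rewrite pE mulNrz mulrC.
Qed.

Lemma wpair_alt al : wpair al al = 0.
Proof.
have H : forall (I : seq 'I_n), \sum_(i <- I) \sum_(j <- I)
    p i j *~ (al 0 i * al 0 j) = 0.
  elim=> [|i I IH]; first by rewrite big_nil.
  rewrite big_cons big_cons p0 mul0rz add0r.
  under [X in _ + X]eq_bigr do rewrite big_cons.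
  rewrite big_split /= IH addr0 -big_split /= big1 // => j _.
  by rewrite pE mulNrz mulrC addNr.
exact: H.
Qed.

Local Definition wpA al be : R := (wpair al be)%:A.

Local Lemma wpADl al al' be : wpA (al + al') be = wpA al be + wpA al' be.
Proof. by rewrite /wpA wpairDl scalerDl. Qed.

Local Lemma wpADr al be be' : wpA al (be + be') = wpA al be + wpA al be'.
Proof. by rewrite /wpA wpairDr scalerDl. Qed.

Local Lemma wpAC al be : wpA al be = - wpA be al.
Proof. by rewrite /wpA wpairC scaleNr. Qed.

Local Lemma wder_wpA ga al be : wder ga (wpA al be) = 0.
Proof.
rewrite wderZ /wder big1 ?scaler0 // => i _.
by rewrite (pder1 (dP i)) mul0rz.
Qed.

Local Lemma pbr_wpA r al be : pbr r (wpA al be) = 0.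
Proof. by rewrite pbrZr pbr1r scaler0. Qed.

Local Lemma skew_coefE al be r s : skew_coef al be r s =
  pbr r s + wder be r * s - r * wder al s + wpA al be * (r * s).
Proof. by rewrite /skew_coef -[wpair al be *: _]mulr_algl. Qed.

Local Lemma skew_bracketC f g : skew_bracket f g = - skew_bracket g f.
Proof.
move: f g; apply: (span_mulN (@lmonD _ _ _) (@lmon_ind _ _ _)
  skew_bracketDl skew_bracketDr skew_bracketUU) => al be r s.
by rewrite /skew_coef pbrC wpairC scaleNr (mulrC r s); ring.
Qed.

Local Lemma skew_bracket_alt f : skew_bracket f f = 0.
Proof.
move: f; apply: (span_alt (@lmonD _ _ _) (@lmon_ind _ _ _)
  skew_bracketDl skew_bracketDr skew_bracketUU skew_bracketC) => al r.
by rewrite /skew_coef pbr_alt wpair_alt scale0r; ring.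
Qed.

Local Lemma skew_bracket_leibniz f g h :
  skew_bracket f (g * h) = skew_bracket f g * h + g * skew_bracket f h.
Proof.
move: f g h; apply: (span_leibniz (@lmonD _ _ _) (@lmonM _ _ _)
  (@lmon_ind _ _ _) skew_bracketDl skew_bracketDr skew_bracketUU).
move=> al be ga r s t.
rewrite !skew_coefE pbrMr wderDl wderM wpADr.
by ring.
Qed.

Local Lemma skew_bracket_jacobi f g h :
  skew_bracket f (skew_bracket g h) + skew_bracket g (skew_bracket h f)
    + skew_bracket h (skew_bracket f g) = 0.
Proof.
move: f g h; apply: (span_jacobi (@lmonD _ _ _)
  (@lmon_ind _ _ _) skew_bracketDl skew_bracketDr skew_bracketUU).
move=> al be ga r s t.
rewrite !skew_coefE !wderDl !wpADr.
have wderN x r' : wder x (- r') = - wder x r'.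
  by rewrite -scaleN1r wderZ scaleN1r.
rewrite !(wderD, wderN, wderM, wder_pbr, wder_wpA).
rewrite !(pbrDr, pbrNr, pbrMr, pbr_wpA).
have J : pbr r (pbr s t) = - pbr s (pbr t r) - pbr t (pbr r s).
  by apply/eqP; rewrite -subr_eq0 opprD !opprK addrA pbr_jacobi.
rewrite J (wderC be al t) (wderC ga al s) (wderC ga be r).
rewrite (wpAC be al) (wpAC ga al) (wpAC ga be).
rewrite (pbrC s r) (pbrC t r) (pbrC t s).
rewrite (pbrC s (wder _ r)) (pbrC t (wder _ r)) (pbrC t (wder _ s)).
rewrite (pbrC (wder _ t) r) !pbrNr.
by ring.
Qed.

Local Lemma skew_bracketZ c f g :
  skew_bracket (c *: f) g = c *: skew_bracket f g.
Proof.
rewrite !laurentZE; move: f g; apply: (span_brZl (@lmonM _ _ _)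
  (@lmon_ind _ _ _) skew_bracketDl skew_bracketDr skew_bracketUU).
move=> al be r s; rewrite !mulr_algl /skew_coef pbrZl wderZ.
by rewrite -!scalerAl !scalerDr scalerN !scalerA [_ * c]mulrC.
Qed.

Lemma skew_bracketP : is_poisson_bracket skew_bracket.
Proof.
split.
- by move=> c f g h; rewrite skew_bracketDl skew_bracketZ.
- move=> c f g h; rewrite skew_bracketDr skew_bracketC skew_bracketZ.
  by rewrite -scalerN -skew_bracketC.
- exact: skew_bracket_alt.
- exact: skew_bracket_jacobi.
- exact: skew_bracket_leibniz.
Qed.

Definition skew_laurent : poissonAlg k := PoissonAlg skew_bracketP.

End SkewLaurent.

(* A skew biderivation is a Poisson bracket as soon as alternation and the
   Jacobi identity hold on generators. *)
Section Biderivation.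
Variables (A : comNzRingType) (G : A -> Prop) (br : A -> A -> A).
Hypothesis gen_ind : forall Q : A -> Prop, (forall f, G f -> Q f) ->
  (forall f g, Q f -> Q g -> Q (f + g)) ->
  (forall f g, Q f -> Q g -> Q (f * g)) -> forall f, Q f.
Hypothesis brDr : forall f g h, br f (g + h) = br f g + br f h.
Hypothesis brMr : forall f g h, br f (g * h) = br f g * h + g * br f h.
Hypothesis brC : forall f g, br f g = - br g f.

Lemma bider_Dl f g h : br (f + g) h = br f h + br g h.
Proof. by rewrite brC brDr opprD -!brC. Qed.

Lemma bider_Ml f g h : br (f * g) h = br f h * g + f * br g h.
Proof. by rewrite brC brMr (brC h f) (brC h g); ring. Qed.

Lemma bider_0r f : br f 0 = 0.
Proof. by apply: (addrI (br f 0)); rewrite -brDr !addr0. Qed.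

Lemma bider_Nr f g : br f (- g) = - br f g.
Proof. by apply: (addrI (br f g)); rewrite -brDr !subrr bider_0r. Qed.

Lemma bider_alt : (forall f, G f -> br f f = 0) -> forall f, br f f = 0.
Proof.
move=> H; apply: gen_ind => // f g ef eg.
  by rewrite bider_Dl !brDr ef eg (brC g f); ring.
by rewrite bider_Ml !brMr ef eg (brC g f); ring.
Qed.

Let J f g h := br f (br g h) + br g (br h f) + br h (br f g).

Local Lemma jac_cyc f g h : J f g h = J g h f.
Proof. by rewrite /J; ring. Qed.

Local Lemma jacD f f' g h : J (f + f') g h = J f g h + J f' g h.
Proof. by rewrite /J !(bider_Dl, brDr); ring. Qed.

Local Lemma jacM f f' g h : J (f * f') g h = f * J f' g h + f' * J f g h.
Proof.
rewrite /J !(bider_Ml, brDr, brMr).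
rewrite (brC h f) (brC h f') (brC g f) (brC g f') !bider_Nr.
by ring.
Qed.

Local Lemma jacD2 f g g' h : J f (g + g') h = J f g h + J f g' h.
Proof. by rewrite /J !(bider_Dl, brDr); ring. Qed.

Local Lemma jacD3 f g h h' : J f g (h + h') = J f g h + J f g h'.
Proof. by rewrite /J !(bider_Dl, brDr); ring. Qed.

Local Lemma jacM2 f g g' h : J f (g * g') h = g * J f g' h + g' * J f g h.
Proof. by rewrite (jac_cyc f) jacM -(jac_cyc f g') -(jac_cyc f g). Qed.

Local Lemma jacM3 f g h h' : J f g (h * h') = h * J f g h' + h' * J f g h.
Proof.
by rewrite -(jac_cyc (h * h')) jacM (jac_cyc h f) (jac_cyc h' f).
Qed.

Lemma bider_jacobi :
  (forall f g h, G f -> G g -> G h ->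
     br f (br g h) + br g (br h f) + br h (br f g) = 0) ->
  forall f g h, br f (br g h) + br g (br h f) + br h (br f g) = 0.
Proof.
move=> H.
have H1 g h : G g -> G h -> forall f, J f g h = 0.
  move=> Gg Gh; apply: gen_ind => [f Gf|f f' e e'|f f' e e'].
  - exact: H.
  - by rewrite jacD e e' addr0.
  - by rewrite jacM e e' !mulr0 addr0.
have H2 f h : G h -> forall g, J f g h = 0.
  move=> Gh; apply: gen_ind => [g Gg|g g' e e'|g g' e e'].
  - exact: H1.
  - by rewrite jacD2 e e' addr0.
  - by rewrite jacM2 e e' !mulr0 addr0.
move=> f g; change (forall h, J f g h = 0).
apply: gen_ind => [h Gh|h h' e e'|h h' e e'].
- exact: H2.
- by rewrite jacD3 e e' addr0.
- by rewrite jacM3 e e' !mulr0 addr0.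
Qed.

End Biderivation.

Lemma mpoly_gen_ind (R : comNzRingType) (n : nat) (Q : {mpoly R[n]} -> Prop) :
  (forall f, ((exists c, f = c%:MP) \/ (exists u, f = 'X_u)) -> Q f) ->
  (forall f g, Q f -> Q g -> Q (f + g)) ->
  (forall f g, Q f -> Q g -> Q (f * g)) -> forall f, Q f.
Proof.
move=> QG QD QM f.
have QC c : Q c%:MP by apply: QG; left; exists c.
have QX u : Q 'X_u by apply: QG; right; exists u.
have Q1 : Q 1 by rewrite -mpolyC1.
rewrite [f]mpolyE; apply: (big_ind Q) => [||m _]; [by rewrite -mpolyC0|by []|].
rewrite -mul_mpolyC; apply: (QM) => //; rewrite mpolyXE_id.
apply: (big_ind Q) => // i _.
by elim: (m i) => [|e IH]; rewrite ?expr0 // exprS; apply: (QM).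
Qed.

Lemma mpoly_mon_ind (R : comNzRingType) (n : nat) (Q : {mpoly R[n]} -> Prop) :
  Q 0 -> (forall f g, Q f -> Q g -> Q (f + g)) ->
  (forall r m, Q (r *: 'X_[m])) -> forall f, Q f.
Proof. by move=> Q0 QD QX f; rewrite [f]mpolyE; apply: (big_ind Q). Qed.

Section CoefBracket.
Variables (k : fieldType) (R : poissonAlg k) (N : nat).
Local Notation P := {mpoly R[N]}.

(* {r X^m, s X^m'} = {r, s} X^(m + m'). *)
Definition coef_bracket (f g : P) : P :=
  \sum_(m <- msupp f) \sum_(m' <- msupp g) pbr f@_m g@_m' *: 'X_[m + m'].

Lemma coef_bracketE j f g : (msize f <= j)%N -> (msize g <= j)%N ->
  coef_bracket f g = \sum_(m : 'X_{1..N < j}) \sum_(m' : 'X_{1..N < j})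
    pbr f@_m g@_m' *: 'X_[m + m'].
Proof.
move=> lf lg; pose I : subFinType _ := 'X_{1..N < j}.
rewrite /coef_bracket (ssrcomplements.big_mksub I) //=; first last.
- by move=> x /msize_mdeg_lt/leq_trans; apply.
- by rewrite msupp_uniq.
rewrite big_rmcond //= => [|i /memN_msupp_eq0 ->]; last first.
  by rewrite big1 // => m' _; rewrite pbr0l scale0r.
apply: eq_bigr => m _; rewrite (ssrcomplements.big_mksub I) //=; first last.
- by move=> x /msize_mdeg_lt/leq_trans; apply.
- by rewrite msupp_uniq.
by rewrite big_rmcond //= => i /memN_msupp_eq0 ->; rewrite pbr0r scale0r.
Qed.

Lemma coef_bracketDr f g h :
  coef_bracket f (g + h) = coef_bracket f g + coef_bracket f h.
Proof.
pose j := maxn (msize f) (maxn (msize g) (maxn (msize h) (msize (g + h)))).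
rewrite !(@coef_bracketE j) ?leq_max ?leqnn ?orbT //.
rewrite -big_split; apply: eq_bigr => m _ /=.
rewrite -big_split; apply: eq_bigr => m' _ /=.
by rewrite mcoeffD pbrDr scalerDl.
Qed.

Lemma coef_bracketC f g : coef_bracket f g = - coef_bracket g f.
Proof.
rewrite /coef_bracket exchange_big -sumrN; apply: eq_bigr => m _ /=.
by rewrite -sumrN; apply: eq_bigr => m' _; rewrite pbrC scaleNr addmC.
Qed.

Lemma coef_bracketDl f g h :
  coef_bracket (f + g) h = coef_bracket f h + coef_bracket g h.
Proof. by rewrite coef_bracketC coef_bracketDr opprD -!coef_bracketC. Qed.

Lemma coef_bracket0l f : coef_bracket 0 f = 0.
Proof. by rewrite /coef_bracket msupp0 big_nil. Qed.
Lemma coef_bracket0r f : coef_bracket f 0 = 0.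
Proof. by rewrite coef_bracketC coef_bracket0l oppr0. Qed.

Lemma coef_bracketXX r s m m' :
  coef_bracket (r *: 'X_[m]) (s *: 'X_[m']) = pbr r s *: 'X_[m + m'].
Proof.
have [->|r0] := eqVneq r 0.
  by rewrite scale0r coef_bracket0l pbr0l scale0r.
have [->|s0] := eqVneq s 0.
  by rewrite scale0r coef_bracket0r pbr0r scale0r.
rewrite /coef_bracket !msuppMCX // !big_seq1.
by rewrite !mcoeffZ !mcoeffX !eqxx !mulr1.
Qed.

Lemma coef_bracketMr f g h :
  coef_bracket f (g * h) = coef_bracket f g * h + g * coef_bracket f h.
Proof.
elim/mpoly_mon_ind: f => [|f1 f2 e1 e2|r m].
- by rewrite !coef_bracket0l mul0r mulr0 addr0.
- by rewrite !coef_bracketDl e1 e2; ring.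
elim/mpoly_mon_ind: g => [|f1 f2 e1 e2|s m'].
- by rewrite !mul0r !coef_bracket0r mul0r addr0.
- by rewrite !(mulrDl, coef_bracketDr) e1 e2; ring.
elim/mpoly_mon_ind: h => [|f1 f2 e1 e2|t m''].
- by rewrite !mulr0 !coef_bracket0r mulr0 addr0.
- by rewrite !(mulrDr, coef_bracketDr) e1 e2; ring.
rewrite -scalerAl -scalerAr scalerA -mpolyXD !coef_bracketXX.
rewrite -!scalerAl -!scalerAr !scalerA -!mpolyXD pbrMr scalerDl.
by rewrite !addmA [(m' + m)%MM]addmC.
Qed.

End CoefBracket.

Section CoefDerivation.
Variables (k : fieldType) (R : poissonAlg k) (N : nat) (d : {linear R -> R}).
Hypothesis dP : poisson_derivation d.

Lemma map_mpoly_derX r m :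
  map_mpoly d (r *: 'X_[m] : {mpoly R[N]}) = d r *: 'X_[m].
Proof.
apply/mpolyP => m'; rewrite mcoeff_map_mpoly !mcoeffZ !mcoeffX.
by case: eqP => _; rewrite ?mulr1 // !mulr0 raddf0.
Qed.

Lemma map_mpoly_derD (f g : {mpoly R[N]}) :
  map_mpoly d (f + g) = map_mpoly d f + map_mpoly d g.
Proof. exact: raddfD. Qed.

Lemma map_mpoly_der0 : map_mpoly d (0 : {mpoly R[N]}) = 0.
Proof. exact: raddf0. Qed.

Lemma map_mpoly_derM (f g : {mpoly R[N]}) :
  map_mpoly d (f * g) = map_mpoly d f * g + f * map_mpoly d g.
Proof.
elim/mpoly_mon_ind: f => [|f1 f2 e1 e2|r m].
- by rewrite !(mul0r, map_mpoly_der0) addr0.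
- by rewrite !(mulrDl, map_mpoly_derD) e1 e2; ring.
elim/mpoly_mon_ind: g => [|f1 f2 e1 e2|s m'].
- by rewrite !(mulr0, map_mpoly_der0) addr0.
- by rewrite !(mulrDr, map_mpoly_derD) e1 e2; ring.
rewrite -scalerAl -scalerAr scalerA -mpolyXD !map_mpoly_derX.
by rewrite -!scalerAl -!scalerAr !scalerA -!mpolyXD (pderM dP) scalerDl.
Qed.

Lemma map_mpoly_derXU u : map_mpoly d ('X_u : {mpoly R[N]}) = 0.
Proof.
by rewrite -[X in map_mpoly d X]scale1r map_mpoly_derX pder1 // scale0r.
Qed.

End CoefDerivation.

Lemma addr3_shuffle (V : zmodType) (a b c a' b' c' : V) :
  a + a' + (b + b') + (c + c') = a + b + c + (a' + b' + c').
Proof. by rewrite (addrACA a) (addrACA (a + b)). Qed.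

Lemma leibniz3_shuffle (A : comNzRingType) (g h a b c a' b' c' : A) :
  a * h + g * a' + (b * h + g * b') + (c * h + g * c') =
  (a + b + c) * h + g * (a' + b' + c').
Proof. by rewrite addr3_shuffle !mulrDl !mulrDr. Qed.

(* In R[x_1, y_1, ..., x_n, y_n] = {mpoly R[n + n]}, the first n variables are
   the x_i and the last n the y_i. *)
Definition xvar (R : comNzRingType) (n : nat) (i : 'I_n) : {mpoly R[n + n]} :=
  'X_(lshift n i).
Definition yvar (R : comNzRingType) (n : nat) (i : 'I_n) : {mpoly R[n + n]} :=
  'X_(rshift n i).

Section PolyBracket.
Variables (k : fieldType) (R : poissonAlg k) (n : nat).
Variables (d : 'I_n -> {linear R -> R}) (a : 'I_n -> R).
Variables (mu gamma : 'I_n -> 'I_n -> k).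
Local Notation P := {mpoly R[n + n]}.
Local Notation xvar := (@xvar R n).
Local Notation yvar := (@yvar R n).

(* Brackets of the variables; inl i stands for x_i and inr i for y_i. *)
Definition gen_bracket (u v : 'I_(n + n)) : P :=
  match split u, split v with
  | inl i, inl j => if i == j then 0
                    else (gamma i j - mu i j)%:A *: (xvar i * xvar j)
  | inr i, inl j => if i == j then (d i (a i))%:MP
                    else (mu i j)%:A *: (xvar j * yvar i)
  | inl i, inr j => if i == j then - (d j (a j))%:MP
                    else - ((mu j i)%:A *: (xvar i * yvar j))
  | inr i, inr j => if i == j then 0
                    else (mu j i - gamma i j)%:A *: (yvar i * yvar j)
  end.

Definition xy_euler (i : 'I_n) (f : P) : P :=
  xvar i * f^`M(lshift n i) - yvar i * f^`M(rshift n i).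

(* The biderivation of R[x, y] extending the bracket of R, equal to gen_bracket
   on the variables, and with {r, x_i} = d_i(r) x_i, {r, y_i} = - d_i(r) y_i. *)
Definition poly_bracket (f g : P) : P :=
  coef_bracket f g
  + \sum_i (map_mpoly (d i) f * xy_euler i g - xy_euler i f * map_mpoly (d i) g)
  + \sum_u \sum_v f^`M(u) * g^`M(v) * gen_bracket u v.

Hypothesis dP : forall i, poisson_derivation (d i).
Hypothesis dC : forall i j r, d i (d j r) = d j (d i r).
Hypothesis aC : forall i, poisson_central (a i).
Hypothesis gammaP : forall i j, i != j -> d j (a i) = gamma i j *: a i.
Hypothesis sumP : forall i j, i != j -> gamma i j + gamma j i = mu i j + mu j i.

Lemma gen_bracketC u v : gen_bracket u v = - gen_bracket v u.
Proof.
rewrite /gen_bracket; case: (split u) => i; case: (split v) => j;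
  rewrite [j == i]eq_sym; case: (eqVneq i j) => [eij|ij];
  rewrite ?eij ?oppr0 ?opprK //.
- rewrite -scaleNr -scaleNr [xvar j * _]mulrC; congr (_%:A *: _).
  by apply/eqP; rewrite -subr_eq0 opprK addrACA sumP // -opprD subrr.
- rewrite -scaleNr -scaleNr [yvar j * _]mulrC; congr (_%:A *: _).
  apply/eqP; rewrite -subr_eq0 opprK addrACA -opprD sumP //.
  by rewrite [mu j i + _]addrC subrr.
Qed.

Lemma xy_eulerD i f g : xy_euler i (f + g) = xy_euler i f + xy_euler i g.
Proof. by rewrite /xy_euler !mderivD; ring. Qed.

Lemma xy_eulerM i f g :
  xy_euler i (f * g) = xy_euler i f * g + f * xy_euler i g.
Proof. by rewrite /xy_euler !mderivM; ring. Qed.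

Local Definition dpart f g : P :=
  \sum_i (map_mpoly (d i) f * xy_euler i g - xy_euler i f * map_mpoly (d i) g).
Local Definition gpart f g : P :=
  \sum_u \sum_v f^`M(u) * g^`M(v) * gen_bracket u v.

Local Lemma poly_bracketE f g :
  poly_bracket f g = coef_bracket f g + dpart f g + gpart f g.
Proof. by []. Qed.

Local Lemma dpartD f g h : dpart f (g + h) = dpart f g + dpart f h.
Proof.
rewrite /dpart -big_split; apply: eq_bigr => i _ /=.
by rewrite xy_eulerD map_mpoly_derD; ring.
Qed.

Local Lemma dpartM f g h : dpart f (g * h) = dpart f g * h + g * dpart f h.
Proof.
rewrite /dpart mulr_suml mulr_sumr -big_split; apply: eq_bigr => i _ /=.
by rewrite xy_eulerM map_mpoly_derM //; ring.
Qed.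

Local Lemma dpartC f g : dpart f g = - dpart g f.
Proof. by rewrite /dpart -sumrN; apply: eq_bigr => i _; ring. Qed.

Local Lemma gpartD f g h : gpart f (g + h) = gpart f g + gpart f h.
Proof.
rewrite /gpart -big_split; apply: eq_bigr => u _ /=.
rewrite -big_split; apply: eq_bigr => v _ /=.
by rewrite mderivD; ring.
Qed.

Local Lemma gpartM f g h : gpart f (g * h) = gpart f g * h + g * gpart f h.
Proof.
rewrite /gpart mulr_suml mulr_sumr -big_split; apply: eq_bigr => u _ /=.
rewrite mulr_suml mulr_sumr -big_split; apply: eq_bigr => v _ /=.
by rewrite mderivM; ring.
Qed.

Local Lemma gpartC f g : gpart f g = - gpart g f.
Proof.
rewrite /gpart exchange_big -sumrN; apply: eq_bigr => u _ /=.
by rewrite -sumrN; apply: eq_bigr => v _; rewrite gen_bracketC; ring.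
Qed.

Lemma poly_bracketDr f g h :
  poly_bracket f (g + h) = poly_bracket f g + poly_bracket f h.
Proof.
by rewrite !poly_bracketE coef_bracketDr dpartD gpartD; apply: addr3_shuffle.
Qed.

Lemma poly_bracketC f g : poly_bracket f g = - poly_bracket g f.
Proof.
by rewrite !poly_bracketE coef_bracketC dpartC gpartC !opprD.
Qed.

Lemma poly_bracketMr f g h :
  poly_bracket f (g * h) = poly_bracket f g * h + g * poly_bracket f h.
Proof.
rewrite !poly_bracketE coef_bracketMr dpartM gpartM.
exact: leibniz3_shuffle.
Qed.

Definition der_var (u : 'I_(n + n)) (r : R) : R :=
  match split u with inl i => d i r | inr i => - d i r end.

Lemma map_mpoly_derC i r : map_mpoly (d i) (r%:MP : P) = (d i r)%:MP.
Proof.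
by rewrite -[r%:MP]mulr1 -mpolyX0 mul_mpolyC map_mpoly_derX -mul_mpolyC
           mpolyX0 mulr1.
Qed.

Lemma xy_eulerC i r : xy_euler i r%:MP = 0.
Proof. by rewrite /xy_euler !mderivC !mulr0 subrr. Qed.

Lemma mderivXU (u v : 'I_(n + n)) : ('X_u : P)^`M(v) = (u == v)%:R.
Proof.
rewrite mderivX mnm1E; case: eqVneq => [->|_]; last by rewrite scale0r.
rewrite scale1r (_ : (U_(v) - U_(v))%MM = 0%MM) ?mpolyX0 //.
by apply/mnmP=> i; rewrite mnmBE subnn mnm0E.
Qed.

Lemma poly_bracketCC r s : poly_bracket r%:MP s%:MP = (pbr r s)%:MP.
Proof.
rewrite poly_bracketE /dpart /gpart big1 => [|i _]; last first.
  by rewrite !xy_eulerC mulr0 mul0r subrr.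
rewrite big1 => [|u _]; last first.
  by rewrite big1 // => v _; rewrite mderivC !mul0r.
have E c : c%:MP = c *: 'X_[0] :> P by rewrite mpolyX0 -mul_mpolyC mulr1.
by rewrite !E coef_bracketXX addm0 !addr0.
Qed.

Lemma poly_bracketCX r u : poly_bracket r%:MP 'X_u = (der_var u r)%:MP * 'X_u.
Proof.
rewrite poly_bracketE /gpart [X in _ + X]big1 => [|v _]; last first.
  by rewrite big1 // => w _; rewrite mderivC !mul0r.
have -> : coef_bracket r%:MP ('X_u : P) = 0.
  have E c : c%:MP = c *: 'X_[0] :> P by rewrite mpolyX0 -mul_mpolyC mulr1.
  by rewrite E -['X_u]scale1r coef_bracketXX pbr1r scale0r.
rewrite add0r addr0 /dpart.
under eq_bigr do
  rewrite map_mpoly_derC xy_eulerC mul0r subr0 /xy_euler !mderivXU.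
rewrite /der_var; case: split_ordP => i ->; rewrite (bigD1 i) //= big1.
- by rewrite eqxx eq_lrshift mulr1 mulr0 subr0 addr0.
- move=> j ji; rewrite eq_lshift eq_lrshift eq_sym (negPf ji).
  by rewrite !mulr0 subr0 mulr0.
- by rewrite eqxx eq_rlshift mulr1 mulr0 sub0r addr0 mulrN mpolyCN mulNr.
- move=> j ji; rewrite eq_rshift eq_rlshift eq_sym (negPf ji).
  by rewrite !mulr0 subr0 mulr0.
Qed.

Lemma poly_bracketXX u v : poly_bracket 'X_u 'X_v = gen_bracket u v.
Proof.
rewrite poly_bracketE /dpart big1 => [|i _]; last first.
  by rewrite !map_mpoly_derXU // mulr0 mul0r subrr.
have -> : coef_bracket ('X_u : P) 'X_v = 0.
  by rewrite -['X_u]scale1r -['X_v]scale1r coef_bracketXX pbr1r scale0r.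
rewrite !add0r /gpart (bigD1 u) //= (bigD1 v) //= !mderivXU !eqxx !mul1r.
rewrite big1 => [|w wv]; last first.
  by rewrite mderivXU eq_sym (negPf wv) mulr0 mul0r.
rewrite big1 => [|w wu]; first by rewrite !addr0.
by rewrite big1 // => w' _; rewrite mderivXU eq_sym (negPf wu) !mul0r.
Qed.

End PolyBracket.

Section PolyJacobi.
Variables (k : fieldType) (R : poissonAlg k) (n : nat).
Variables (d : 'I_n -> {linear R -> R}) (a : 'I_n -> R).
Variables (mu gamma : 'I_n -> 'I_n -> k).
Hypothesis dP : forall i, poisson_derivation (d i).
Hypothesis dC : forall i j r, d i (d j r) = d j (d i r).
Hypothesis aC : forall i, poisson_central (a i).
Hypothesis gammaP : forall i j, i != j -> d j (a i) = gamma i j *: a i.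
Hypothesis sumP : forall i j, i != j -> gamma i j + gamma j i = mu i j + mu j i.
Local Notation P := {mpoly R[n + n]}.
Local Notation br := (poly_bracket d a mu gamma).
Local Notation D := (der_var d).

Local Definition cvar (u v : 'I_(n + n)) : k :=
  match split u, split v with
  | inl i, inl j => if i == j then 0 else gamma i j - mu i j
  | inr i, inl j => if i == j then 0 else mu i j
  | inl i, inr j => if i == j then 0 else - mu j i
  | inr i, inr j => if i == j then 0 else mu j i - gamma i j
  end.

Local Definition evar (u v : 'I_(n + n)) : R :=
  match split u, split v with
  | inr i, inl j => if i == j then d i (a i) else 0
  | inl i, inr j => if i == j then - d j (a j) else 0
  | _, _ => 0
  end.

Local Definition CP u v : P := ((cvar u v)%:A)%:MP.
Local Definition EP u v : P := (evar u v)%:MP.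

Local Lemma splitl i : split (lshift n i) = inl i :> 'I_n + 'I_n.
Proof. exact: (unsplitK (inl i)). Qed.
Local Lemma splitr i : split (rshift n i) = inr i :> 'I_n + 'I_n.
Proof. exact: (unsplitK (inr i)). Qed.

Local Lemma gen_bracketCE u v :
  gen_bracket d a mu gamma u v = CP u v * ('X_u * 'X_v) + EP u v.
Proof.
rewrite /gen_bracket /CP /EP /cvar /evar.
case: (split_ordP u) => i ->; case: (split_ordP v) => j ->;
  case: (eqVneq i j) => [->|ij].
- by rewrite scale0r mpolyC0 mul0r addr0.
- by rewrite mul_mpolyC mpolyC0 addr0.
- by rewrite scale0r mpolyC0 mul0r add0r mpolyCN.
- by rewrite mul_mpolyC mpolyC0 addr0 !scaleNr.
- by rewrite scale0r mpolyC0 mul0r add0r.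
- by rewrite mul_mpolyC mpolyC0 addr0 [xvar _ _ * _]mulrC.
- by rewrite scale0r mpolyC0 mul0r addr0.
- by rewrite mul_mpolyC mpolyC0 addr0.
Qed.

Local Lemma cvarC u v : cvar u v = - cvar v u.
Proof.
rewrite /cvar; case: (split u) => i; case: (split v) => j;
  rewrite [j == i]eq_sym; case: (eqVneq i j) => [eij|ij];
  rewrite ?oppr0 ?opprK // opprB.
- apply/eqP; rewrite -subr_eq0; apply/eqP.
  rewrite (_ : _ - _ = gamma i j + gamma j i - (mu i j + mu j i)); last by ring.
  by rewrite sumP // subrr.
- apply/eqP; rewrite -subr_eq0; apply/eqP.
  rewrite (_ : _ - _ = mu i j + mu j i - (gamma i j + gamma j i)); last by ring.
  by rewrite sumP // subrr.
Qed.

Local Lemma evarC u v : evar u v = - evar v u.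
Proof.
rewrite /evar; case: (split u) => i; case: (split v) => j;
  rewrite ?[j == i]eq_sym ?oppr0 //; case: (eqVneq i j) => [eij|ij];
  by rewrite ?eij ?oppr0 ?opprK.
Qed.

Local Lemma CPC u v : CP u v = - CP v u.
Proof. by rewrite /CP cvarC scaleNr mpolyCN. Qed.
Local Lemma EPC u v : EP u v = - EP v u.
Proof. by rewrite /EP evarC mpolyCN. Qed.

Local Lemma dA i c : d i (c%:A) = 0.
Proof. by rewrite linearZ /= (pder1 (dP i)) scaler0. Qed.

Local Lemma pbr_central r i c : poisson_central c -> pbr r (d i c) = 0.
Proof.
move=> cC; have := pder_pbr (dP i) c r; rewrite cC raddf0 cC addr0 => e.
by rewrite pbrC -e oppr0.
Qed.

Local Lemma pbr_evar r u v : pbr r (evar u v) = 0.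
Proof.
rewrite /evar; case: (split u) => i; case: (split v) => j;
  rewrite ?pbr0r //; case: eqP => _; rewrite ?pbr0r // ?pbrNr;
  by rewrite pbr_central // ?oppr0.
Qed.

Local Lemma der_a i j : i != j -> d j (d i (a i)) = gamma i j *: d i (a i).
Proof. by move=> ij; rewrite dC gammaP // linearZ. Qed.

Local Lemma der_evar u v w : u != v -> u != w ->
  D u (evar v w) = (cvar w u - cvar u v) *: evar v w.
Proof.
rewrite /der_var /evar /cvar.
case: (split_ordP v) => i ->; case: (split_ordP w) => i' ->;
  case: (split_ordP u) => j ->;
  rewrite ?raddf0 ?oppr0 ?scaler0 //; case: (eqVneq i i') => [<-|_];
  rewrite ?raddf0 ?oppr0 ?scaler0 // ?eq_lshift ?eq_rshift => h1 h2.
- have ij : i != j by rewrite eq_sym.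
  rewrite (negPf h1) (negPf ij) raddfN /= der_a // scalerN; congr (- (_ *: _)).
  apply/eqP; rewrite -subr_eq0; apply/eqP.
  rewrite (_ : _ - _ = gamma i j + gamma j i - (mu i j + mu j i)).
    by rewrite sumP // subrr.
  by ring.
- have ij : i != j by rewrite eq_sym.
  rewrite (negPf h2) (negPf ij) raddfN /= der_a // opprK scalerN -scaleNr.
  by congr (_ *: _); rewrite opprB opprD opprK; ring.
- have ij : i != j by rewrite eq_sym.
  rewrite (negPf h2) (negPf ij) der_a //; congr (_ *: _).
  by ring.
- have ij : i != j by rewrite eq_sym.
  rewrite (negPf h1) (negPf ij) der_a // -scaleNr; congr (_ *: _).
  apply/eqP; rewrite -subr_eq0; apply/eqP.
  rewrite (_ : _ - _ = - (gamma i j + gamma j i) + (mu i j + mu j i)).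
    by rewrite sumP // addNr.
  by ring.
Qed.

Local Lemma brC f g : br f g = - br g f.
Proof. exact: poly_bracketC. Qed.
Local Lemma brDr f g h : br f (g + h) = br f g + br f h.
Proof. exact: poly_bracketDr. Qed.
Local Lemma brMr f g h : br f (g * h) = br f g * h + g * br f h.
Proof. exact: poly_bracketMr. Qed.
Local Lemma brDl f g h : br (f + g) h = br f h + br g h.
Proof. exact: (bider_Dl brDr brC). Qed.
Local Lemma brMl f g h : br (f * g) h = br f h * g + f * br g h.
Proof. exact: (bider_Ml brMr brC). Qed.
Local Lemma brNr f g : br f (- g) = - br f g.
Proof. exact: (bider_Nr brDr). Qed.
Local Lemma brCC r s : br r%:MP s%:MP = (pbr r s)%:MP.
Proof. exact: poly_bracketCC. Qed.
Local Lemma brCX r u : br r%:MP 'X_u = (D u r)%:MP * 'X_u.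
Proof. exact: poly_bracketCX. Qed.
Local Lemma brXC r u : br 'X_u r%:MP = - ((D u r)%:MP * 'X_u).
Proof. by rewrite brC brCX. Qed.
Local Lemma brXX u v : br 'X_u 'X_v = CP u v * ('X_u * 'X_v) + EP u v.
Proof. by rewrite poly_bracketXX // gen_bracketCE. Qed.

Local Lemma DA u c : D u c%:A = 0.
Proof. by rewrite /der_var; case: split => i; rewrite dA ?oppr0. Qed.

Local Lemma brC_CP r u v : br r%:MP (CP u v) = 0.
Proof. by rewrite brCC pbrZr pbr1r scaler0 mpolyC0. Qed.
Local Lemma brX_CP w u v : br 'X_w (CP u v) = 0.
Proof. by rewrite brXC DA mpolyC0 mul0r oppr0. Qed.
Local Lemma brC_EP r u v : br r%:MP (EP u v) = 0.
Proof. by rewrite brCC pbr_evar mpolyC0. Qed.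

Local Lemma DpbrE u r s : D u (pbr r s) = pbr (D u r) s + pbr r (D u s).
Proof.
rewrite /der_var; case: split => i; rewrite (pder_pbr (dP i)) //.
by rewrite pbrNl pbrNr opprD.
Qed.

Local Lemma DC u v r : D u (D v r) = D v (D u r).
Proof.
rewrite /der_var; case: (split u) => i; case: (split v) => j;
  by rewrite ?raddfN /= dC.
Qed.

Local Lemma jacCCX r s u :
  br r%:MP (br s%:MP 'X_u) + br s%:MP (br 'X_u r%:MP)
  + br 'X_u (br r%:MP s%:MP) = 0.
Proof.
rewrite brXC brNr !brCX !brMr !brCC !brCX brXC DpbrE mpolyCD.
rewrite (pbrC (D u r) s) mpolyCN; by ring.
Qed.

Local Lemma jacCXX r u v :
  br r%:MP (br 'X_u 'X_v) + br 'X_u (br 'X_v r%:MP)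
  + br 'X_v (br r%:MP 'X_u) = 0.
Proof.
have EPD : ((D u r)%:MP + (D v r)%:MP) * EP u v = 0.
  rewrite /EP -mpolyCD -mpolyCM /der_var /evar.
  case: (split u) => i; case: (split v) => j; rewrite ?mulr0 ?mpolyC0 //;
    case: eqP => [->|_]; rewrite ?mulr0 ?mpolyC0 //.
    by rewrite subrr mul0r mpolyC0.
  by rewrite addNr mul0r mpolyC0.
rewrite brXC brNr brCX !brMr !brXC brXX brDr brC_EP !brMr brC_CP !brCX.
rewrite (DC u v) ?brXX (CPC v u) (EPC v u) ?mpolyCN.
rewrite -[RHS]oppr0 -[in RHS]EPD; by ring.
Qed.

Local Lemma brX_EP u v w : u != v -> u != w ->
  br 'X_u (EP v w) = (CP u v - CP w u) * EP v w * 'X_u.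
Proof.
move=> uv uw; rewrite brXC der_evar // -mulr_algl mpolyCM scalerBl mpolyCB.
by rewrite /CP /EP; ring.
Qed.

Local Lemma jac2 u w : br 'X_u (br 'X_u 'X_w) + br 'X_u (br 'X_w 'X_u)
  + br 'X_w (br 'X_u 'X_u) = 0.
Proof.
have -> : br 'X_u 'X_u = 0.
  rewrite brXX /CP /EP /cvar /evar; case: (split u) => i; rewrite eqxx;
  by rewrite scale0r mpolyC0 mul0r addr0.
rewrite (bider_0r brDr) addr0 (brC 'X_w) brNr subrr //.
Qed.

Local Lemma jacXXX u v w :
  br 'X_u (br 'X_v 'X_w) + br 'X_v (br 'X_w 'X_u)
  + br 'X_w (br 'X_u 'X_v) = 0.
Proof.
have [->|uv] := eqVneq u v; first exact: jac2.
have [->|vw] := eqVneq v w; first by rewrite -addrA addrC; exact: jac2.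
have [->|wu] := eqVneq w u; first by rewrite addrC addrA; exact: jac2.
rewrite (brXX v w) (brXX w u) (brXX u v).
rewrite !brDr !brMr !brX_CP !brXX !brX_EP //; try by rewrite eq_sym.
rewrite (CPC v u) (CPC w v) (CPC u w) (EPC v u) (EPC w v) (EPC u w).
by ring.
Qed.

Lemma poly_bracket_jacobi f g h :
  br f (br g h) + br g (br h f) + br h (br f g) = 0.
Proof.
apply: (bider_jacobi (@mpoly_gen_ind _ _) brDr brMr brC) => {f g h}.
move=> f g h [[r ->]|[u ->]] [[s ->]|[v ->]] [[t ->]|[w ->]].
- by rewrite !brCC -!mpolyCD pbr_jacobi mpolyC0.
- exact: jacCCX.
- by rewrite addrC addrA; exact: jacCCX.
- exact: jacCXX.
- by rewrite -addrA addrC; exact: jacCCX.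
- by rewrite -addrA addrC; exact: jacCXX.
- by rewrite addrC addrA; exact: jacCXX.
- exact: jacXXX.
Qed.

Lemma poly_bracket_alt f : br f f = 0.
Proof.
move: f; apply: (bider_alt (@mpoly_gen_ind _ _) brDr brMr brC).
move=> f [[r ->]|[u ->]]; first by rewrite brCC pbr_alt mpolyC0.
rewrite brXX /CP /EP /cvar /evar; case: (split u) => i; rewrite eqxx;
by rewrite scale0r mpolyC0 mul0r addr0.
Qed.

Local Lemma br_alg0 c g : br (c%:A)%:MP g = 0.
Proof.
move: g; apply: (@mpoly_gen_ind _ _) => [f [[r ->]|[u ->]]|f g e e'|f g e e'].
- by rewrite brCC pbrC pbrZr pbr1r scaler0 oppr0 mpolyC0.
- by rewrite brCX DA mpolyC0 mul0r.
- by rewrite brDr e e' addr0.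
- by rewrite brMr e e' mul0r mulr0 addr0.
Qed.

Lemma poly_bracketZl c f g : br ((c%:A)%:MP * f) g = (c%:A)%:MP * br f g.
Proof. by rewrite brMl br_alg0 mul0r add0r. Qed.

Lemma poly_bracket_rel f i :
  exists h, br f (yvar R i * xvar R i - (a i)%:MP)
            = h * (yvar R i * xvar R i - (a i)%:MP).
Proof.
set rho := _ - _; move: f.
have G u : exists h, br 'X_u rho = h * rho.
  rewrite /rho brDr brNr brMr brXC /xvar /yvar.
  have [j ->|j ->] := split_ordP u; rewrite !poly_bracketXX // /gen_bracket.
    rewrite /der_var !splitl !splitr; case: (eqVneq j i) => [->|ji].
      by exists 0; rewrite mul0r; ring.
    exists (- ((gamma i j)%:A)%:MP * 'X_(lshift n j)).
    rewrite gammaP ?[i == j]eq_sym // -(mulr_algl (gamma i j) (a i)) mpolyCM.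
    have e : gamma j i - mu j i = mu i j - gamma i j.
      apply/eqP; rewrite -subr_eq0; apply/eqP.
      rewrite (_ : _ - _ = gamma i j + gamma j i - (mu i j + mu j i)).
        by rewrite sumP 1?eq_sym // subrr.
      by ring.
    rewrite e -!mul_mpolyC scalerBl mpolyCB /xvar /yvar.
    by ring.
  rewrite /der_var !splitl !splitr; case: (eqVneq j i) => [->|ji].
    by exists 0; rewrite mul0r !mpolyCN; ring.
  exists (((gamma i j)%:A)%:MP * 'X_(rshift n j)).
  rewrite gammaP ?[i == j]eq_sym // -(mulr_algl (gamma i j) (a i)).
  rewrite mpolyCN mpolyCM.
  have e : mu i j - gamma j i = gamma i j - mu j i.
    apply/eqP; rewrite -subr_eq0; apply/eqP.
    rewrite (_ : _ - _ = (mu i j + mu j i) - (gamma i j + gamma j i)).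
      by rewrite sumP 1?eq_sym // subrr.
    by ring.
  rewrite e -!mul_mpolyC scalerBl mpolyCB /xvar /yvar.
  by ring.
apply: (@mpoly_gen_ind _ _) => [f [[r ->]|[u ->]]|f g|f g].
- exists 0; rewrite mul0r /rho brDr brNr brMr /xvar /yvar !brCX brCC.
  by rewrite pbrC aC oppr0 mpolyC0 /der_var splitl splitr mpolyCN; ring.
- exact: G.
- by move=> [h e] [h' e']; exists (h + h'); rewrite brDl e e' mulrDl.
- move=> [h e] [h' e']; exists (h * g + f * h').
  by rewrite brMl e e'; ring.
Qed.

End PolyJacobi.

Section GwaRing.
Variables (k : fieldType) (R : comAlgType k) (n : nat) (a : 'I_n -> R).
Local Notation P := {mpoly R[n + n]}.
Local Open Scope quotient_scope.

Definition gwa_rel (i : 'I_n) : P := yvar R i * xvar R i - (a i)%:MP.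

(* The ideal is proper for every a: x_i |-> a_i, y_i |-> 1 kills it. *)
Definition gwa_ideal (f : P) : bool :=
  boolp.asbool (exists c : 'I_n -> P, f = \sum_i c i * gwa_rel i).

Lemma gwa_idealP f :
  reflect (exists c : 'I_n -> P, f = \sum_i c i * gwa_rel i) (gwa_ideal f).
Proof. exact: boolp.asboolP. Qed.

Lemma gwa_ideal_closed : idealr_closed gwa_ideal.
Proof.
split=> [||f g h].
- by apply/gwa_idealP; exists (fun=> 0); rewrite big1 // => i _; rewrite mul0r.
- apply/negP => /gwa_idealP[c /(congr1 (meval (fun u => match split u with
     inl i => a i | inr _ => 1 end)))].
  rewrite meval1 raddf_sum big1 /= => [/eqP|i _]; first by rewrite oner_eq0.
  rewrite mevalM mevalB mevalM mevalC !mevalXU.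
  rewrite (unsplitK (inl i)) (unsplitK (inr i)).
  by rewrite mul1r subrr mulr0.
- move=> /gwa_idealP[c ->] /gwa_idealP[c' ->].
  apply/gwa_idealP; exists (fun i => f * c i + c' i).
  rewrite mulr_sumr -big_split; apply: eq_bigr => i _ /=.
  by rewrite mulrDl mulrA.
Qed.

Lemma gwa_idealD f g : gwa_ideal f -> gwa_ideal g -> gwa_ideal (f + g).
Proof.
move=> /gwa_idealP[c ->] /gwa_idealP[c' ->].
apply/gwa_idealP; exists (fun i => c i + c' i).
by rewrite -big_split; apply: eq_bigr => i _; rewrite mulrDl.
Qed.

HB.instance Definition _ := isIdealr.Build P gwa_ideal gwa_ideal_closed.

Definition gwa_idealr : idealr P := gwa_ideal.

Definition gwa : Type := {ideal_quot gwa_idealr}.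

HB.instance Definition _ := GRing.ComNzRing.copy gwa {ideal_quot gwa_idealr}.

Definition gwa_pi (f : P) : gwa := \pi_({ideal_quot gwa_idealr}) f.

Lemma gwa_piP f g : (gwa_pi f = gwa_pi g) <-> gwa_ideal (f - g).
Proof.
have E : gwa_ideal (f - g) = (gwa_pi f == gwa_pi g).
  exact: (Quotient.idealrBE gwa_idealr f g).
by rewrite E; split=> /eqP.
Qed.

Lemma gwa_piD f g : gwa_pi (f + g) = gwa_pi f + gwa_pi g.
Proof. by rewrite /gwa_pi; apply: raddfD. Qed.
Lemma gwa_piM f g : gwa_pi (f * g) = gwa_pi f * gwa_pi g.
Proof. by rewrite /gwa_pi; apply: rmorphM. Qed.
Lemma gwa_pi1 : gwa_pi 1 = 1.
Proof. by rewrite /gwa_pi; apply: rmorph1. Qed.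
Lemma gwa_pi0 : gwa_pi 0 = 0.
Proof. by rewrite /gwa_pi; apply: raddf0. Qed.

Definition gwa_repr (u : gwa) : P := repr (u : {ideal_quot gwa_idealr}).
Lemma gwa_reprK u : gwa_pi (gwa_repr u) = u.
Proof. exact: reprK. Qed.

Definition gwa_scale (c : k) (u : gwa) : gwa := gwa_pi (c%:A)%:MP * u.

Local Lemma gwa_scaleA b c u :
  gwa_scale b (gwa_scale c u) = gwa_scale (b * c) u.
Proof.
rewrite /gwa_scale (mulrA (gwa_pi _) (gwa_pi _) u) -gwa_piM -mpolyCM.
by rewrite -scalerAl mul1r scalerA.
Qed.
Local Lemma gwa_scale1 : left_id 1 gwa_scale.
Proof. by move=> u; rewrite /gwa_scale scale1r gwa_pi1 mul1r. Qed.
Local Lemma gwa_scaleDr : right_distributive gwa_scale +%R.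
Proof. by move=> b u v; rewrite /gwa_scale mulrDr. Qed.
Local Lemma gwa_scaleDl u : {morph gwa_scale^~ u : b c / b + c}.
Proof. by move=> b c; rewrite /gwa_scale scalerDl mpolyCD gwa_piD mulrDl. Qed.

HB.instance Definition _ := GRing.Zmodule_isLmodule.Build k gwa
  gwa_scaleA gwa_scale1 gwa_scaleDr gwa_scaleDl.

Local Lemma gwa_scaleAl c (u v : gwa) : c *: (u * v) = (c *: u) * v.
Proof. exact: mulrA. Qed.

HB.instance Definition _ := GRing.Lmodule_isLalgebra.Build k gwa gwa_scaleAl.
HB.instance Definition _ := GRing.Lalgebra_isComAlgebra.Build k gwa.

Lemma gwaZE c (u : gwa) : c *: u = gwa_pi (c%:A)%:MP * u.
Proof. by []. Qed.

Definition gwaC (r : R) : gwa := gwa_pi r%:MP.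
Definition gwaX (i : 'I_n) : gwa := gwa_pi (xvar R i).
Definition gwaY (i : 'I_n) : gwa := gwa_pi (yvar R i).

End GwaRing.

Section TGWPA.
Variables (k : fieldType) (R : poissonAlg k) (n : nat).
Variables (d : 'I_n -> {linear R -> R}) (a : 'I_n -> R).
Variables (mu gamma : 'I_n -> 'I_n -> k).
Local Notation A := (gwa a).
Local Notation pi := (@gwa_pi k R n a).
Local Notation br := (poly_bracket d a mu gamma).

(* Well defined: see tgwp_bracketE.  The defining relations are the lemmas
   gwaYX and tgwp_CC, _CX, _CY, _YX, _YX_neq, _XX, _YY at the end of the file. *)
Definition tgwp_bracket (u v : A) : A := pi (br (gwa_repr u) (gwa_repr v)).

Hypothesis dP : forall i, poisson_derivation (d i).
Hypothesis dC : forall i j r, d i (d j r) = d j (d i r).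
Hypothesis aC : forall i, poisson_central (a i).
Hypothesis gammaP : forall i j, i != j -> d j (a i) = gamma i j *: a i.
Hypothesis sumP : forall i j, i != j -> gamma i j + gamma j i = mu i j + mu j i.

Local Lemma brC' f g : br f g = - br g f.
Proof. exact: poly_bracketC. Qed.
Local Lemma brDr' f g h : br f (g + h) = br f g + br f h.
Proof. exact: poly_bracketDr. Qed.
Local Lemma brMr' f g h : br f (g * h) = br f g * h + g * br f h.
Proof. exact: poly_bracketMr. Qed.
Local Lemma brNr' f g : br f (- g) = - br f g.
Proof. exact: (bider_Nr brDr'). Qed.

Local Lemma br_ideal f g : gwa_ideal a g -> gwa_ideal a (br f g).
Proof.
move=> /gwa_idealP[c ->].
have H (r : seq 'I_n) : gwa_ideal a (br f (\sum_(i <- r) c i * gwa_rel a i)).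
  elim: r => [|i r IH].
    by rewrite big_nil (bider_0r brDr'); apply: (idealr0 (gwa_idealr a)).
  rewrite big_cons brDr' brMr'.
  have [h ->] := poly_bracket_rel dP aC gammaP sumP f i.
  apply: gwa_idealD => //.
  rewrite -/(gwa_rel a i) mulrA -mulrDl.
  apply/gwa_idealP; exists (fun j => if j == i then br f (c i) + c i * h else 0).
  rewrite (bigD1 i) //= eqxx big1 ?addr0 // => j /negPf ->.
  by rewrite mul0r.
exact: H.
Qed.

Lemma tgwp_bracketE f g : tgwp_bracket (pi f) (pi g) = pi (br f g).
Proof.
have H f1 g1 g2 : pi g1 = pi g2 -> pi (br f1 g1) = pi (br f1 g2).
  move=> /gwa_piP I; apply/gwa_piP; rewrite -brNr' -brDr'; exact: br_ideal.
rewrite /tgwp_bracket (H _ _ g) ?gwa_reprK //.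
have N h : pi (- h) = - pi h.
  by apply: (addrI (pi h)); rewrite -gwa_piD !subrr gwa_pi0.
by rewrite brC' N (H _ _ f) ?gwa_reprK // -N -brC'.
Qed.

Lemma tgwp_bracketP : is_poisson_bracket tgwp_bracket.
Proof.
have Zl c f g : tgwp_bracket (c *: f) g = c *: tgwp_bracket f g.
  rewrite -[f]gwa_reprK -[g]gwa_reprK !gwaZE -gwa_piM !tgwp_bracketE.
  by rewrite poly_bracketZl // gwa_piM.
have Dr f g h : tgwp_bracket f (g + h) = tgwp_bracket f g + tgwp_bracket f h.
  rewrite -[f]gwa_reprK -[g]gwa_reprK -[h]gwa_reprK -gwa_piD !tgwp_bracketE.
  by rewrite brDr' gwa_piD.
have C f g : tgwp_bracket f g + tgwp_bracket g f = 0.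
  rewrite -[f]gwa_reprK -[g]gwa_reprK !tgwp_bracketE -gwa_piD.
  by rewrite brC' addNr gwa_pi0.
have C' f g : tgwp_bracket f g = - tgwp_bracket g f.
  by apply/eqP; rewrite -addr_eq0 C.
split.
- by move=> c f g h; rewrite C' Dr opprD -!C' Zl.
- by move=> c f g h; rewrite Dr C' Zl -scalerN -C'.
- move=> f; rewrite -[f]gwa_reprK tgwp_bracketE poly_bracket_alt //.
  exact: gwa_pi0.
- move=> f g h; rewrite -[f]gwa_reprK -[g]gwa_reprK -[h]gwa_reprK.
  by rewrite !tgwp_bracketE -!gwa_piD poly_bracket_jacobi // gwa_pi0.
- move=> f g h; rewrite -[f]gwa_reprK -[g]gwa_reprK -[h]gwa_reprK.
  by rewrite -gwa_piM !tgwp_bracketE -!gwa_piM -gwa_piD brMr'.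
Qed.

Definition tgwpa : poissonAlg k := PoissonAlg tgwp_bracketP.

End TGWPA.

Inductive gen_subalg (k : fieldType) (A : comAlgType k) (G : A -> Prop) :
    A -> Prop :=
| gen_subalg_gen f : G f -> gen_subalg G f
| gen_subalg_one : gen_subalg G 1
| gen_subalg_lin (c : k) f g :
    gen_subalg G f -> gen_subalg G g -> gen_subalg G (c *: f + g)
| gen_subalg_mul f g : gen_subalg G f -> gen_subalg G g -> gen_subalg G (f * g).

Section GenSubalg.
Variables (k : fieldType) (A : comAlgType k) (G : A -> Prop).

Definition gen_subalg_pred : {pred A} := fun f => boolp.asbool (gen_subalg G f).

Lemma gen_subalgP f : reflect (gen_subalg G f) (f \in gen_subalg_pred).
Proof. exact: boolp.asboolP. Qed.

Lemma gen_subalg_closed : GRing.subalg_closed gen_subalg_pred.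
Proof.
split.
- by apply/gen_subalgP; apply: gen_subalg_one.
- move=> c f g /gen_subalgP hf /gen_subalgP hg.
  by apply/gen_subalgP; apply: gen_subalg_lin.
- move=> f g /gen_subalgP hf /gen_subalgP hg.
  by apply/gen_subalgP; apply: gen_subalg_mul.
Qed.

HB.instance Definition _ := GRing.isSubalgClosed.Build k A gen_subalg_pred
  gen_subalg_closed.

Record subalg : Type := Subalg {
  subalg_val :> A;
  subalg_valP : subalg_val \in gen_subalg_pred }.

HB.instance Definition _ := [isSub for subalg_val].
HB.instance Definition _ := [Choice of subalg by <:].
HB.instance Definition _ := [SubChoice_isSubComNzRing of subalg by <:].
HB.instance Definition _ := [SubZmodule_isSubLmodule of subalg by <:].
HB.instance Definition _ := [SubNzRing_SubLmodule_isSubLalgebra of subalg by <:].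
HB.instance Definition _ := [SubLalgebra_isSubAlgebra of subalg by <:].

End GenSubalg.

Section PoissonSubalg.
Variables (k : fieldType) (A : poissonAlg k) (G : A -> Prop).
Hypothesis GP : forall f g, G f -> G g -> gen_subalg G (pbr f g).

Lemma gen_subalg_pbr f g :
  gen_subalg G f -> gen_subalg G g -> gen_subalg G (pbr f g).
Proof.
have add u v : gen_subalg G u -> gen_subalg G v -> gen_subalg G (u + v).
  by move=> hu hv; rewrite -[u]scale1r; apply: gen_subalg_lin.
have z : gen_subalg G 0.
  rewrite -[0](subrr (1 : A)) addrC -scaleN1r.
  by apply: gen_subalg_lin; apply: gen_subalg_one.
move=> hf; elim=> {g} [g Gg||c g g' _ IH _ IH'|g g' hg IH hg' IH'].
- elim: hf => {f} [f Gf||c f f' _ IH _ IH'|f f' hf IH hf' IH'].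
  + exact: GP.
  + by rewrite pbr1l.
  + by rewrite pbrDl pbrZl; apply: gen_subalg_lin.
  + by rewrite pbrMl; apply: add; apply: gen_subalg_mul.
- by rewrite pbr1r.
- by rewrite pbrDr pbrZr; apply: gen_subalg_lin.
- by rewrite pbrMr; apply: add; apply: gen_subalg_mul.
Qed.

Definition subalg_pbr (u v : subalg G) : subalg G :=
  Subalg (introT (gen_subalgP _ _)
    (gen_subalg_pbr (elimT (gen_subalgP _ _) (subalg_valP u))
                    (elimT (gen_subalgP _ _) (subalg_valP v)))).

Lemma subalg_pbrP : is_poisson_bracket subalg_pbr.
Proof.
split=> [c f g h|c f g h|f|f g h|f g h]; apply: val_inj => /=.
- by rewrite pbrDl pbrZl.
- by rewrite pbrDr pbrZr.
- exact: pbr_alt.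
- exact: pbr_jacobi.
- exact: pbrMr.
Qed.

Definition poisson_subalg : poissonAlg k := PoissonAlg subalg_pbrP.

End PoissonSubalg.

Section LaurentGens.
Variables (k : fieldType) (R : comAlgType k) (n : nat).
Definition laurentC (r : R) : laurent R n := lmon r 0.
Definition laurentT (i : 'I_n) : laurent R n := lmon 1 (delta_mx 0 i).
Definition laurentTV (i : 'I_n) : laurent R n := lmon 1 (- delta_mx 0 i).

Lemma laurentTK i : laurentT i * laurentTV i = 1.
Proof. by rewrite /laurentT /laurentTV lmonM mul1r subrr. Qed.
End LaurentGens.

Section SkewLaurentRelations.
Variables (k : fieldType) (R : poissonAlg k) (n : nat).
Variables (d : 'I_n -> {linear R -> R}) (p : 'M[k]_n).
Local Notation K := 'rV[int]_n.
Local Notation br := (skew_bracket d p).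
Local Notation e_ := (fun i : 'I_n => delta_mx 0 i : K).
Hypothesis dP : forall i, poisson_derivation (d i).

Lemma wderT i r : wder d (e_ i) r = d i r.
Proof.
rewrite /wder (bigD1 i) //= mxE !eqxx mulr1z big1 ?addr0 // => j ji.
by rewrite mxE (negPf ji) andbF mulr0z.
Qed.

Lemma wderN al r : wder d (- al) r = - wder d al r.
Proof. by apply: (addrI (wder d al r)); rewrite -wderDl !subrr wder0l. Qed.

Lemma wderTV i r : wder d (- e_ i) r = - d i r.
Proof. by rewrite wderN wderT. Qed.

Lemma wpairNl al be : wpair p (- al) be = - wpair p al be.
Proof.
by apply: (addrI (wpair p al be)); rewrite -wpairDl !subrr wpair0l.
Qed.

Lemma wpairNr al be : wpair p al (- be) = - wpair p al be.
Proof.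
by apply: (addrI (wpair p al be)); rewrite -wpairDr !subrr wpair0r.
Qed.

Lemma wpairTT i j : wpair p (e_ i) (e_ j) = p i j.
Proof.
rewrite /wpair (bigD1 i) //= (bigD1 j) //= !mxE !eqxx mulr1 mulr1z.
rewrite !big1 ?addr0 // => [i' ii'|j' jj'].
  by rewrite big1 // => j' _; rewrite !mxE (negPf ii') andbF mul0r mulr0z.
by rewrite !mxE (negPf jj') andbF mulr0 mulr0z.
Qed.

Lemma wder1 al : wder d al 1 = 0.
Proof. by rewrite /wder big1 // => i _; rewrite (pder1 (dP i)) mul0rz. Qed.

Lemma skew_bracket_CC r s :
  br (laurentC n r) (laurentC n s) = laurentC n (pbr r s).
Proof.
rewrite /laurentC skew_bracketUU addr0 /skew_coef !wder0l wpair0l scale0r.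
by rewrite mul0r mulr0 subr0 !addr0.
Qed.

Lemma skew_bracket_CU r b al : (forall s, pbr b s = 0) ->
  br (laurentC n r) (lmon b al) = laurentC n (wder d al r) * lmon b al.
Proof.
move=> bC; rewrite /laurentC skew_bracketUU lmonM /skew_coef.
by rewrite pbrC bC oppr0 wder0l mulr0 subr0 wpair0l scale0r addr0 add0r.
Qed.

Lemma skew_bracket_CT r i :
  br (laurentC n r) (laurentT R i) = laurentC n (d i r) * laurentT R i.
Proof. by rewrite skew_bracket_CU ?wderT // => s; rewrite pbr1l. Qed.

Lemma skew_bracket_CTV r i :
  br (laurentC n r) (laurentTV R i) = - (laurentC n (d i r) * laurentTV R i).
Proof.
rewrite skew_bracket_CU ?wderTV; last by move=> s; rewrite pbr1l.
rewrite -mulNr; congr (_ * _); apply: (addrI (laurentC n (d i r))).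
by rewrite /laurentC -lmonD !subrr lmon0.
Qed.

Lemma skew_bracket_TT i j :
  br (laurentT R i) (laurentT R j) = p i j *: (laurentT R i * laurentT R j).
Proof.
rewrite laurentZE /laurentT !lmonM skew_bracketUU /skew_coef !wder1 wpairTT.
by rewrite pbr1l mul0r mulr0 subr0 !add0r !mulr1.
Qed.

Lemma skew_bracket_TTV i j :
  br (laurentT R i) (laurentTV R j) =
  - (p i j *: (laurentT R i * laurentTV R j)).
Proof.
rewrite -scaleNr laurentZE /laurentT /laurentTV !lmonM skew_bracketUU.
rewrite /skew_coef !wder1.
by rewrite wpairNr wpairTT pbr1l mul0r mulr0 subr0 !add0r !mulr1.
Qed.

End SkewLaurentRelations.

Section PMatrix.
Variables (k : fieldType) (n : nat) (mu gamma : 'I_n -> 'I_n -> k).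

Definition p_mx : 'M[k]_n :=
  \matrix_(i, j) (if i == j then 0 else gamma i j - mu i j).

Lemma p_mx_diag i : p_mx i i = 0.
Proof. by rewrite mxE eqxx. Qed.

Hypothesis sumP : forall i j, i != j -> gamma i j + gamma j i = mu i j + mu j i.

Lemma p_mx_skew : p_mx^T = - p_mx.
Proof.
apply/matrixP => i j; rewrite !mxE [j == i]eq_sym.
case: (eqVneq i j) => [_|ij]; first by rewrite oppr0.
apply/eqP; rewrite -subr_eq0; apply/eqP.
rewrite (_ : _ - _ = gamma i j + gamma j i - (mu i j + mu j i)); last by ring.
by rewrite sumP // subrr.
Qed.

End PMatrix.

Section SPrime.
Variables (k : fieldType) (R : poissonAlg k) (n : nat).
Variables (d : 'I_n -> {linear R -> R}) (a : 'I_n -> R).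
Variables (mu gamma : 'I_n -> 'I_n -> k).

Definition sprime_gen (f : laurent R n) : Prop :=
  (exists r, f = laurentC n r) \/
  (exists i, f = laurentT R i) \/
  (exists i, f = laurentC n (a i) * laurentTV R i).

Hypothesis dP : forall i, poisson_derivation (d i).
Hypothesis dC : forall i j r, d i (d j r) = d j (d i r).
Hypothesis aC : forall i, poisson_central (a i).
Hypothesis gammaP : forall i j, i != j -> d j (a i) = gamma i j *: a i.
Hypothesis sumP : forall i j, i != j -> gamma i j + gamma j i = mu i j + mu j i.

Definition tgwp_laurent : poissonAlg k :=
  skew_laurent dP dC (p_mx_skew sumP) (p_mx_diag mu gamma).

Local Notation S := tgwp_laurent.
Local Notation p := (p_mx mu gamma).
Local Notation br := (skew_bracket d p).
Local Notation I := (@gen_subalg_pred k (laurent R n) sprime_gen).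
Local Notation e_ := (fun i : 'I_n => delta_mx 0 i : 'rV[int]_n).

Local Lemma sgenE i :
  laurentC n (a i) * laurentTV R i = lmon (a i) (- e_ i).
Proof. by rewrite /laurentC /laurentTV lmonM mulr1 add0r. Qed.

Local Lemma sC r : laurentC n r \in I.
Proof. by apply/gen_subalgP/gen_subalg_gen; left; exists r. Qed.
Local Lemma sT i : laurentT R i \in I.
Proof. by apply/gen_subalgP/gen_subalg_gen; right; left; exists i. Qed.
Local Lemma sS i : lmon (a i) (- e_ i) \in I.
Proof.
by apply/gen_subalgP/gen_subalg_gen; right; right; exists i; rewrite sgenE.
Qed.

Local Lemma sbrC f g : br f g = - br g f.
Proof. exact: (pbrC (f : S) g). Qed.

Local Lemma sprime_CU r b al : (forall s, pbr b s = 0) -> lmon b al \in I ->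
  br (laurentC n r) (lmon b al) \in I.
Proof.
move=> bC bI; rewrite (skew_bracket_CU _ _ _ _ bC).
exact: rpredM (sC _) bI.
Qed.

Local Lemma sprime_UU b c al be x : lmon b al \in I -> lmon c be \in I ->
  skew_coef d p al be b c = x *: (b * c) -> br (lmon b al) (lmon c be) \in I.
Proof.
move=> bI cI e; rewrite skew_bracketUU e.
suff -> : lmon (x *: (b * c)) (al + be) = x *: (lmon b al * lmon c be).
  by apply: rpredZ; apply: rpredM.
rewrite (lmonM b c al be) laurentZE (lmonM x%:A (b * c) 0 (al + be)) add0r.
by rewrite mulr_algl.
Qed.

Local Lemma sprime_TS i j : br (laurentT R j) (lmon (a i) (- e_ i)) \in I.
Proof.
have [->|ij] := eqVneq j i.
  by rewrite /laurentT skew_bracketUU subrr; apply: sC.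
apply: (@sprime_UU _ _ _ _ (- gamma i j - p j i)); [exact: sT|exact: sS|].
rewrite /skew_coef pbr1l wder1 // mul0r addr0 add0r wderT wpairNr wpairTT.
by rewrite gammaP 1?eq_sym // !mul1r scalerBl !scaleNr.
Qed.

Local Lemma sprime_SS i j :
  br (lmon (a i) (- e_ i)) (lmon (a j) (- e_ j)) \in I.
Proof.
have [->|ij] := eqVneq j i.
  have -> : br (lmon (a i) (- e_ i)) (lmon (a i) (- e_ i)) = 0.
    exact: (pbr_alt (lmon (a i) (- e_ i) : S)).
  exact: rpred0.
apply: (@sprime_UU _ _ _ _ (- gamma i j + gamma j i + p i j));
  [exact: sS|exact: sS|].
rewrite /skew_coef aC !wderTV wpairNl wpairNr wpairTT opprK.
rewrite gammaP 1?eq_sym // gammaP //.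
by rewrite !scalerDl scaleNr add0r mulNr mulrN opprK -scalerAl -scalerAr.
Qed.

Lemma sprime_gen_pbr (f g : S) :
  sprime_gen f -> sprime_gen g -> gen_subalg sprime_gen (pbr f g).
Proof.
have c1 (s : R) : pbr 1 s = 0 by apply: pbr1l.
have E (h : laurent R n) : sprime_gen h -> (exists r, h = laurentC n r) \/
    (exists i, h = laurentT R i) \/ (exists i, h = lmon (a i) (- e_ i)).
  case=> [[r ->]|[[i ->]|[i ->]]]; first by left; exists r.
    by right; left; exists i.
  by right; right; exists i; apply: sgenE.
have sbrI h h' : br h' h \in I -> br h h' \in I.
  by move=> hI; rewrite (sbrC h h') rpredN.
have H : forall f g : laurent R n, sprime_gen f -> sprime_gen g -> br f g \in I.
  move=> {}f {}g /E[[r ->]|[[i ->]|[i ->]]] /E[[s ->]|[[j ->]|[j ->]]].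
  - by rewrite skew_bracket_CC; apply: sC.
  - by apply: sprime_CU => //; apply: sT.
  - by apply: sprime_CU; [exact: aC|exact: sS].
  - by apply: sbrI; apply: sprime_CU => //; apply: sT.
  - rewrite (skew_bracket_TT _ dP); apply: rpredZ; apply: rpredM; exact: sT.
  - exact: sprime_TS.
  - by apply: sbrI; apply: sprime_CU; [exact: aC|exact: sS].
  - by apply: sbrI; apply: sprime_TS.
  - exact: sprime_SS.
by move=> hf hg; apply/gen_subalgP; apply: H.
Qed.

Definition sprime : poissonAlg k := poisson_subalg sprime_gen_pbr.

End SPrime.

Section TGWPARelations.
Variables (k : fieldType) (R : poissonAlg k) (n : nat).
Variables (d : 'I_n -> {linear R -> R}) (a : 'I_n -> R).
Variables (mu gamma : 'I_n -> 'I_n -> k).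
Hypothesis dP : forall i, poisson_derivation (d i).
Hypothesis dC : forall i j r, d i (d j r) = d j (d i r).
Hypothesis aC : forall i, poisson_central (a i).
Hypothesis gammaP : forall i j, i != j -> d j (a i) = gamma i j *: a i.
Hypothesis sumP : forall i j, i != j -> gamma i j + gamma j i = mu i j + mu j i.
Local Notation br := (@tgwp_bracket k R n d a mu gamma).
Local Notation C := (@gwaC k R n a).
Local Notation X := (@gwaX k R n a).
Local Notation Y := (@gwaY k R n a).

Lemma gwaYX i : Y i * X i = C (a i).
Proof.
rewrite /gwaY /gwaX /gwaC -gwa_piM; apply/gwa_piP/gwa_idealP.
exists (fun j => (j == i)%:R).
rewrite (bigD1 i) //= eqxx mul1r big1 ?addr0 // => j /negPf ->.
by rewrite mul0r.
Qed.

Lemma tgwp_CC r s : br (C r) (C s) = C (pbr r s).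
Proof. by rewrite tgwp_bracketE // poly_bracketCC. Qed.

Lemma tgwp_CX r i : br (C r) (X i) = C (d i r) * X i.
Proof.
by rewrite tgwp_bracketE // poly_bracketCX // /der_var splitl gwa_piM.
Qed.

Lemma tgwp_CY r i : br (C r) (Y i) = - (C (d i r) * Y i).
Proof.
rewrite tgwp_bracketE // poly_bracketCX // /der_var splitr.
apply/eqP; rewrite -addr_eq0 -gwa_piM -gwa_piD -mulrDl -mpolyCD addNr.
by rewrite mpolyC0 mul0r gwa_pi0.
Qed.

Lemma gwa_piZ c f : gwa_pi a (c%:A *: f) = c *: gwa_pi a f.
Proof. by rewrite -mul_mpolyC gwa_piM. Qed.

Lemma tgwp_YX i : br (Y i) (X i) = C (d i (a i)).
Proof.
by rewrite tgwp_bracketE // poly_bracketXX // /gen_bracket splitl splitr eqxx.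
Qed.

Lemma tgwp_YX_neq i j : i != j -> br (Y i) (X j) = mu i j *: (X j * Y i).
Proof.
move=> ij; rewrite tgwp_bracketE // poly_bracketXX // /gen_bracket.
by rewrite splitl splitr (negPf ij) gwa_piZ gwa_piM.
Qed.

Lemma tgwp_XX i j : i != j ->
  br (X i) (X j) = (gamma i j - mu i j) *: (X i * X j).
Proof.
move=> ij; rewrite tgwp_bracketE // poly_bracketXX // /gen_bracket !splitl.
by rewrite (negPf ij) gwa_piZ gwa_piM.
Qed.

Lemma tgwp_YY i j : i != j ->
  br (Y i) (Y j) = (mu j i - gamma i j) *: (Y i * Y j).
Proof.
move=> ij; rewrite tgwp_bracketE // poly_bracketXX // /gen_bracket !splitr.
by rewrite (negPf ij) gwa_piZ gwa_piM.
Qed.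

End TGWPARelations.

(* Main.v *)
(* Sending x_i to t_i and y_i to a_i t_i^-1 defines an R-algebra morphism from
   R[x, y] onto S' that kills every y_i x_i - a_i, hence a surjection
   A_mu -> S'; since both brackets are biderivations, it is Poisson as soon as
   it is so on R and the x_i, y_i.  For injectivity, y_i x_i = a_i lets every
   element of A_mu be written as a sum over al in Z^n of
     r_al x^(al_+) y^(al_-),
   where al_+ and al_- are the positive and negative parts of al.  Its image is
   the sum of the r_al a^(al_-) t^al, which determines the r_al because the a_i
   are regular. *)
From HB Require Import structures.
Require Import Defs.
From mathcomp Require Import all_boot all_order all_algebra.
From mathcomp Require Import ring.
From mathcomp Require boolp.
From mathcomp Require Import monalg mpoly.

Import GRing.Theory.
Local Open Scope ring_scope.

(** For fixed [h], the [g'] satisfying the identity are closed under sums and products, so they are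
    everything once they contain [G]. Skew symmetry then exchanges the arguments, and the same
    induction reduces the other one to [G]. *)
Lemma biderivation_morph (A B : comNzRingType) (G : A -> Prop)
    (brA : A -> A -> A) (brB : B -> B -> B) (phi : {rmorphism A -> B}) :
  (forall Q : A -> Prop, (forall f, G f -> Q f) ->
     (forall f g, Q f -> Q g -> Q (f + g)) ->
     (forall f g, Q f -> Q g -> Q (f * g)) -> forall f, Q f) ->
  (forall f g h, brA f (g + h) = brA f g + brA f h) ->
  (forall f g h, brA f (g * h) = brA f g * h + g * brA f h) ->
  (forall f g, brA f g = - brA g f) ->
  (forall f g h, brB f (g + h) = brB f g + brB f h) ->
  (forall f g h, brB f (g * h) = brB f g * h + g * brB f h) ->
  (forall f g, brB f g = - brB g f) ->
  (forall f g, G f -> G g -> phi (brA f g) = brB (phi f) (phi g)) ->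
  forall f g, phi (brA f g) = brB (phi f) (phi g).
Proof.
move=> ind AD AM AC BD BM BC H f g.
have R h : (forall g', G g' -> phi (brA h g') = brB (phi h) (phi g')) ->
    forall g', phi (brA h g') = brB (phi h) (phi g').
  move=> Hh; apply: ind => [//|g1 g2 e1 e2|g1 g2 e1 e2].
    by rewrite AD !rmorphD BD e1 e2.
  by rewrite AM !(rmorphD, rmorphM) BM e1 e2.
apply: (R f) => g' Gg'; rewrite AC rmorphN BC; congr (- _).
by apply: R => f' Gf'; apply: H.
Qed.

(** * The algebra map from A_mu to the Laurent ring *)

Section NormalForm.
Variables (k : fieldType) (R : comAlgType k) (n : nat) (a : 'I_n -> R).
Local Notation P := (mpoly.mpoly (n + n) R).
Local Notation K := 'rV[int]_n.
Local Notation L := (laurent R n).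
Local Notation e_ i := (delta_mx 0 i : K).

Lemma laurentC_zmod_morphism : zmod_morphism (@laurentC k R n).
Proof.
move=> r s; apply/eqP; rewrite -subr_eq opprK; apply/eqP.
by rewrite /laurentC -lmonD subrK.
Qed.

Lemma laurentC_monoid_morphism : monoid_morphism (@laurentC k R n).
Proof. by split=> // r s; rewrite /laurentC lmonM addr0. Qed.

HB.instance Definition _ :=
  GRing.isZmodMorphism.Build R L (@laurentC k R n) laurentC_zmod_morphism.
HB.instance Definition _ :=
  GRing.isMonoidMorphism.Build R L (@laurentC k R n) laurentC_monoid_morphism.

Lemma gwaC_zmod_morphism : zmod_morphism (gwaC a).
Proof.
move=> r s; apply/eqP; rewrite -subr_eq opprK; apply/eqP.
by rewrite /gwaC -gwa_piD -mpoly.mpolyCD subrK.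
Qed.

Lemma gwaC_monoid_morphism : monoid_morphism (gwaC a).
Proof. by split=> [|r s]; rewrite /gwaC ?gwa_pi1 // mpoly.mpolyCM gwa_piM. Qed.

HB.instance Definition _ :=
  GRing.isZmodMorphism.Build R (gwa a) (gwaC a) gwaC_zmod_morphism.
HB.instance Definition _ :=
  GRing.isMonoidMorphism.Build R (gwa a) (gwaC a) gwaC_monoid_morphism.

HB.instance Definition _ := GRing.isZmodMorphism.Build P (gwa a)
  (@gwa_pi k R n a) (fun f g => raddfB _ f g).
HB.instance Definition _ := GRing.isMonoidMorphism.Build P (gwa a)
  (@gwa_pi k R n a) (conj (gwa_pi1 a) (@gwa_piM k R n a)).

(** The image a_i t_i^-1 of y_i is kept as a single monomial, so that products with it reduce to
    [lmonM]. *)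
Definition var_image (u : 'I_(n + n)) : L :=
  match split u with
  | inl i => laurentT R i
  | inr i => lmon (a i) (- e_ i)
  end.

Definition poly_map : P -> L := mpoly.mmap (@laurentC k R n) var_image.
HB.instance Definition _ := GRing.RMorphism.copy poly_map
  (mpoly.mmap (@laurentC k R n) var_image).

Lemma var_imagel i : var_image (lshift n i) = laurentT R i.
Proof. by rewrite /var_image (unsplitK (inl i)). Qed.

Lemma var_imager i : var_image (rshift n i) = lmon (a i) (- e_ i).
Proof. by rewrite /var_image (unsplitK (inr i)). Qed.

Lemma poly_mapC r : poly_map (mpoly.mpolyC _ r) = laurentC n r.
Proof. exact: mpoly.mmapC. Qed.

Lemma poly_mapX u : poly_map (mpoly.mpolyX R (mpoly.mnm1 u)) = var_image u.
Proof. by rewrite /poly_map mpoly.mmapX mpoly.mmap1U. Qed.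

Lemma poly_map_rel i : poly_map (gwa_rel a i) = 0.
Proof.
rewrite /gwa_rel rmorphB rmorphM /= poly_mapC !poly_mapX var_imagel var_imager.
by rewrite /laurentT lmonM mulr1 addNr subrr.
Qed.

Lemma poly_map_ideal f : gwa_ideal a f -> poly_map f = 0.
Proof.
move=> /gwa_idealP[c ->]; rewrite rmorph_sum big1 // => i _.
by rewrite rmorphM /= poly_map_rel mulr0.
Qed.

(** Evaluates at a chosen representative; by [gwa_mapE] any other gives the same value, since two of
    them differ by an element of the ideal, which [poly_map] kills. *)
Definition gwa_map (u : gwa a) : L := poly_map (gwa_repr u).

Lemma gwa_mapE f : gwa_map (gwa_pi a f) = poly_map f.
Proof.
apply/eqP; rewrite -subr_eq0 /gwa_map -rmorphB; apply/eqP.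
by apply: poly_map_ideal; apply/gwa_piP; rewrite gwa_reprK.
Qed.

Lemma gwa_map_linear : linear gwa_map.
Proof.
move=> c u v; rewrite -[u]gwa_reprK -[v]gwa_reprK gwaZE laurentZE.
by rewrite -rmorphM -rmorphD !gwa_mapE rmorphD rmorphM /= poly_mapC.
Qed.

Lemma gwa_map_monoid_morphism : monoid_morphism gwa_map.
Proof.
split=> [|u v]; first by rewrite -(gwa_pi1 a) gwa_mapE rmorph1.
by rewrite -[u]gwa_reprK -[v]gwa_reprK -rmorphM !gwa_mapE rmorphM.
Qed.

HB.instance Definition _ :=
  GRing.isLinear.Build k (gwa a) L _ gwa_map gwa_map_linear.
HB.instance Definition _ :=
  GRing.isMonoidMorphism.Build (gwa a) L gwa_map gwa_map_monoid_morphism.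

Lemma gwa_mapD u v : gwa_map (u + v) = gwa_map u + gwa_map v.
Proof. exact: raddfD. Qed.

Lemma gwa_mapM u v : gwa_map (u * v) = gwa_map u * gwa_map v.
Proof. exact: rmorphM. Qed.

Lemma gwa_mapC r : gwa_map (gwaC a r) = laurentC n r.
Proof. by rewrite /gwaC gwa_mapE poly_mapC. Qed.

Lemma gwa_mapX i : gwa_map (gwaX a i) = laurentT R i.
Proof. by rewrite /gwaX gwa_mapE poly_mapX var_imagel. Qed.

Lemma gwa_mapY i : gwa_map (gwaY a i) = lmon (a i) (- e_ i).
Proof. by rewrite /gwaY gwa_mapE poly_mapX var_imager. Qed.

(** * Normal forms indexed by Z^n *)

Definition pos_part (z : int) : nat := if z is Posz m then m else 0.
Definition neg_part (z : int) : nat := pos_part (- z).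

Lemma pos_part_sub (p q : nat) : pos_part (p%:Z - q%:Z) = (p - q)%N.
Proof.
have [le_qp|lt_pq] := leqP q p; first by rewrite subzn.
(* For p < q, the integer p - q is [Negz (q - p.+1)], where [pos_part] is 0, as is the truncated
   difference. *)
rewrite -opprB subzn 1?ltnW // -(subnSK lt_pq) -NegzE.
by apply/esym/eqP; rewrite subn_eq0 ltnW.
Qed.

Lemma pos_partB_neg_part z : (pos_part z)%:Z - (neg_part z)%:Z = z.
Proof.
by rewrite /neg_part; case: z => [[|m]|m]; rewrite ?subr0 // sub0r NegzE.
Qed.

Definition gwa_monomial (al : K) : gwa a :=
  \prod_i (gwaX a i ^+ pos_part (al 0 i) * gwaY a i ^+ neg_part (al 0 i)).

Definition neg_coef (al : K) : R := \prod_i a i ^+ neg_part (al 0 i).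

Lemma lmonX r (al : K) m : (lmon r al : L) ^+ m = lmon (r ^+ m) (al *+ m).
Proof.
elim: m => [|m IH]; first by rewrite expr0 mulr0n.
by rewrite [LHS]exprS IH [LHS]lmonM -exprS -mulrS.
Qed.

Lemma lmon_prod (r : 'I_n -> R) (al : 'I_n -> K) :
  \prod_i (lmon (r i) (al i) : L) = lmon (\prod_i r i) (\sum_i al i).
Proof.
apply: (big_rec3 (fun f s be => f = lmon s be)) => [|i _ s be _ ->].
  by [].
exact: lmonM.
Qed.

(** The product x_i^p y_i^q goes to a_i^q t_i^(p - q), and p - q = al_i when p and q are the
    positive and negative parts of al_i. *)
Lemma gwa_map_monomial al : gwa_map (gwa_monomial al) = lmon (neg_coef al) al.
Proof.
rewrite rmorph_prod /=.
under eq_bigr do rewrite rmorphM !rmorphXn /= gwa_mapX gwa_mapY /laurentT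
  !lmonX lmonM expr1n mul1r.
rewrite lmon_prod; congr lmon; rewrite [RHS]row_sum_delta.
apply: eq_bigr => i _; rewrite -[in RHS](pos_partB_neg_part (al 0 i)).
by rewrite scalerBl -!scaler_nat !natz scalerN.
Qed.

(** A Laurent polynomial serves here as the family of coefficients r_al; the map is additive but in
    general not multiplicative. *)
Definition normal_form (f : L) : gwa a :=
  monalg.mmap (gwaC a) gwa_monomial f.

Lemma normal_form_zmod_morphism : zmod_morphism normal_form.
Proof. exact: monalg.mmap_is_additive. Qed.

HB.instance Definition _ :=
  GRing.isZmodMorphism.Build L (gwa a) normal_form normal_form_zmod_morphism.

Lemma normal_formD f g : normal_form (f + g) = normal_form f + normal_form g.
Proof. exact: raddfD. Qed.

Lemma normal_formU r al :
  normal_form (lmon r al) = gwaC a r * gwa_monomial al.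
Proof. exact: monalg.mmapU. Qed.

Lemma lcoefD al (f g : L) : lcoef al (f + g) = lcoef al f + lcoef al g.
Proof. exact: monalg.mcoeffD. Qed.

Lemma lcoefU al be (r : R) : lcoef al (lmon r be : L) = r *+ (be == al).
Proof. exact: monalg.mcoeffU. Qed.

(** By additivity it is enough to look at a monomial, which the composite rescales without moving
    its exponent. *)
Lemma lcoef_gwa_map_normal_form al f :
  lcoef al (gwa_map (normal_form f)) = lcoef al f * neg_coef al.
Proof.
elim/lmon_ind: f => [|f g ef eg|r be].
- by rewrite !raddf0 -[0](lmon0 R 0) lcoefU mul0rn mul0r.
- rewrite normal_formD gwa_mapD [X in _ = X * _]lcoefD [RHS]mulrDl -ef -eg.
  exact: lcoefD.
- rewrite normal_formU gwa_mapM gwa_mapC gwa_map_monomial.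
  rewrite [X in lcoef _ X]lmonM add0r [LHS]lcoefU [in RHS]lcoefU.
  case: eqP => [->|_]; first by rewrite !mulr1n.
  by rewrite !mulr0n mul0r.
Qed.

(* [gwaYX] is the same relation, but only for the underlying algebra of a
   Poisson algebra. *)
Lemma gwa_YX i : gwaY a i * gwaX a i = gwaC a (a i).
Proof.
rewrite /gwaY /gwaX /gwaC -gwa_piM; apply/gwa_piP/gwa_idealP.
exists (fun j => (j == i)%:R); rewrite (bigD1 i) //= eqxx mul1r.
by rewrite big1 ?addr0 // => j /negPf ->; rewrite mul0r.
Qed.

(** Collapsing min(p, q) factors y_i x_i to a_i leaves a pure power of x_i or of y_i. *)
Lemma gwaXY_exp i (p q : nat) :
  gwaX a i ^+ p * gwaY a i ^+ q = gwaC a (a i ^+ minn p q) *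
    (gwaX a i ^+ pos_part (p%:Z - q%:Z) * gwaY a i ^+ neg_part (p%:Z - q%:Z)).
Proof.
rewrite /neg_part opprB !pos_part_sub.
have -> : gwaC a (a i ^+ minn p q) = (gwaY a i * gwaX a i) ^+ minn p q.
  by rewrite gwa_YX; exact: rmorphXn.
rewrite exprMn.
have [le_pq|le_qp] := leqP p q.
  rewrite (eqP (_ : (p - q == 0)%N)) ?subn_eq0 // expr0 mul1r mulrAC -exprD.
  by rewrite subnKC // mulrC.
rewrite (eqP (_ : (q - p == 0)%N)) ?subn_eq0 ?(ltnW le_qp) // expr0 mulr1.
by rewrite -mulrA -exprD subnKC 1?ltnW // mulrC.
Qed.

Lemma normal_form_surj u : exists f, u = normal_form f.
Proof.
rewrite -[u]gwa_reprK; elim/mpoly_mon_ind: (gwa_repr u) => [|f g|r m].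
- by exists 0; rewrite !raddf0.
- by move=> [f' ef] [g' eg]; exists (f' + g'); rewrite !raddfD /= ef eg.
pose p i := m (lshift n i); pose q i := m (rshift n i).
(* By [gwaXY_exp], each index i contributes the exponent p_i - q_i and the factor a_i^min(p_i,
   q_i). *)
exists (lmon (r * \prod_i a i ^+ minn (p i) (q i))
             (\row_i ((p i)%:Z - (q i)%:Z))).
rewrite normal_formU rmorphM /= -mpoly.mul_mpolyC rmorphM -mulrA.
congr (_ * _); rewrite mpoly.mpolyXE_id rmorph_prod /= rmorph_prod.
(* The product over the n + n variables is regrouped into one factor x_i^p_i y_i^q_i per index. *)
rewrite big_split_ord /= /gwa_monomial -!big_split /=.
apply: eq_bigr => i _; rewrite mxE.
apply: (etrans _ (gwaXY_exp i (p i) (q i))).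
by congr (_ * _); exact: rmorphXn.
Qed.

(** * Injectivity from regularity of the a_i *)

Hypothesis areg : forall i, GRing.lreg (a i).

Lemma neg_coef_lreg al : GRing.lreg (neg_coef al).
Proof.
apply: (big_ind (@GRing.lreg R)); [exact: lreg1|exact: lregM|].
by move=> i _; apply: lregX.
Qed.

Lemma gwa_map_inj : injective gwa_map.
Proof.
apply: raddf_inj => u; have [f ->] := normal_form_surj u => f0.
suff -> : f = 0 by rewrite raddf0.
(* Multiplying by the regular [neg_coef al] turns the coefficient of f at al into that of the image,
   which is 0. *)
apply/monalg.malgP => al; apply: (neg_coef_lreg al).
rewrite [LHS]mulrC [RHS]mulrC -[LHS]lcoef_gwa_map_normal_form f0.
by rewrite -[0](lmon0 R 0) [LHS]lcoefU [in RHS]monalg.mcoeffU !mul0rn mul0r.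
Qed.

End NormalForm.


(** * Compatibility with the brackets *)

Section PoissonMap.
Variables (k : fieldType) (R : poissonAlg k) (n : nat).
Variables (d : 'I_n -> {linear R -> R}) (a : 'I_n -> R).
Variables (mu gamma : 'I_n -> 'I_n -> k).
Hypothesis dP : forall i, poisson_derivation (d i).
Hypothesis dC : forall i j r, d i (d j r) = d j (d i r).
Hypothesis aC : forall i, poisson_central (a i).
Hypothesis gammaP : forall i j, i != j -> d j (a i) = gamma i j *: a i.
Hypothesis sumP : forall i j, i != j -> gamma i j + gamma j i = mu i j + mu j i.

Local Notation L := (laurent R n).
Local Notation br := (skew_bracket d (p_mx mu gamma)).
Local Notation S := (tgwp_laurent dP dC sumP).
Local Notation T i := (laurentT R i).
Local Notation e_ i := (delta_mx 0 i : 'rV[int]_n).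
Local Notation V i := (lmon (a i) (- delta_mx 0 i) : L).
Local Notation phi := (poly_map k R n a).

(** This law and the next two are those of the Poisson algebra [S], read on the underlying Laurent
    ring. *)
Lemma skew_brC (f g : L) : br f g = - br g f.
Proof. exact: (pbrC (f : S) g). Qed.

Lemma skew_brDr (f g h : L) : br f (g + h) = br f g + br f h.
Proof. exact: (pbrDr (f : S) g h). Qed.

Lemma skew_brMr (f g h : L) : br f (g * h) = br f g * h + g * br f h.
Proof. exact: (pbrMr (f : S) g h). Qed.

Lemma skew_br_CV r i : br (laurentC n r) (V i) = - (laurentC n (d i r) * V i).
Proof.
rewrite (skew_bracket_CU _ _ _ _ (aC i)) wderTV -mulNr; congr (_ * _).
exact: (raddfN (@laurentC k R n)).
Qed.

Lemma lmonZM c r s (al be : 'rV[int]_n) :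
  c *: ((lmon r al : L) * lmon s be) = lmon (c *: (r * s)) (al + be).
Proof. by rewrite lmonM laurentZE [LHS]lmonM add0r mulr_algl. Qed.

(** Common source of the next two brackets: for i = j the term p_ii vanishes, and for i != j the
    coefficient is (gamma_ij - p_ij) a_i = mu_ij a_i. *)
Lemma skew_coef_VT i j :
  skew_coef d (p_mx mu gamma) (- e_ i) (e_ j) (a i) 1 =
  d j (a i) - p_mx mu gamma i j *: a i.
Proof.
rewrite /skew_coef wderT wder1 // aC add0r mulr0 subr0 !mulr1.
by rewrite wpairNl wpairTT scaleNr.
Qed.

Lemma skew_br_VT_diag i : br (V i) (T i) = laurentC n (d i (a i)).
Proof.
rewrite skew_bracketUU skew_coef_VT p_mx_diag scale0r subr0.
by congr lmon; exact: addNr.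
Qed.

Lemma skew_br_VT i j : i != j -> br (V i) (T j) = mu i j *: (T j * V i).
Proof.
move=> ij; rewrite skew_bracketUU skew_coef_VT gammaP //.
rewrite [RHS]lmonZM.
apply: f_equal2; last exact: addrC.
rewrite mul1r -scalerBl mxE (negPf ij); congr (_ *: _).
by ring.
Qed.

(** The derivations contribute gamma_ji - gamma_ij and the pairing p_ij, in total gamma_ji - mu_ij,
    which [sumP] turns into mu_ji - gamma_ij. *)
Lemma skew_br_VV i j : i != j ->
  br (V i) (V j) = (mu j i - gamma i j) *: (V i * V j).
Proof.
move=> ij; rewrite skew_bracketUU [RHS]lmonZM.
apply: (congr1 (fun r => lmon r _)).
rewrite /skew_coef aC !wderTV wpairNl wpairNr opprK wpairTT.
rewrite gammaP // gammaP 1?eq_sym // add0r mulNr mulrN opprK.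
rewrite -scalerAl -scalerAr -scaleNr -!scalerDl mxE (negPf ij).
congr (_ *: _).
have -> : gamma j i = mu i j + mu j i - gamma i j by rewrite -sumP //; ring.
by ring.
Qed.

Lemma poly_mapZXX c u v : phi (c%:A *: ('X_u * 'X_v)) =
  c *: (var_image k R n a u * var_image k R n a v).
Proof. by rewrite -mul_mpolyC !rmorphM /= poly_mapC !poly_mapX laurentZE. Qed.

(** Worked out on R[x, y], which is generated by constants and variables, whose brackets are
    explicit. *)
Lemma poly_map_bracket f g :
  phi (poly_bracket d a mu gamma f g) = br (phi f) (phi g).
Proof.
apply: (biderivation_morph _ _ _ _ _ _ (@mpoly_gen_ind _ _)) => {f g}.
- exact: poly_bracketDr.
- exact: poly_bracketMr.
- exact: poly_bracketC.
- exact: skew_brDr.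
- exact: skew_brMr.
- exact: skew_brC.
have CX r u : phi (poly_bracket d a mu gamma r%:MP 'X_u) =
    br (phi r%:MP) (phi 'X_u).
  rewrite poly_bracketCX // rmorphM /= !poly_mapC !poly_mapX /der_var.
  case: split_ordP => i ->; rewrite ?var_imagel ?var_imager.
    by rewrite skew_bracket_CT.
  by rewrite skew_br_CV raddfN /= mulNr.
move=> f g [[r ->]|[u ->]] [[s ->]|[v ->]] /=.
- by rewrite poly_bracketCC // !poly_mapC skew_bracket_CC.
- exact: CX.
- by rewrite poly_bracketC // [LHS]rmorphN /= CX -skew_brC.
rewrite poly_bracketXX // !poly_mapX /gen_bracket.
(* The types xx, xy, yx, yy in turn, each first for i = j; the xy cases are the yx ones up to
   sign. *)
case: (split_ordP u) => i ->; case: (split_ordP v) => j ->;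
  rewrite ?var_imagel ?var_imager; case: (eqVneq i j) => [->|ij].
- by rewrite raddf0 -[LHS](pbr_alt (T j : S)).
- rewrite poly_mapZXX !var_imagel (skew_bracket_TT _ dP).
  by rewrite mxE (negPf ij).
- by rewrite [LHS]rmorphN /= poly_mapC skew_brC skew_br_VT_diag.
- rewrite [LHS]rmorphN /= poly_mapZXX var_imagel var_imager.
  by rewrite skew_brC skew_br_VT // eq_sym.
- by rewrite poly_mapC skew_br_VT_diag.
- by rewrite poly_mapZXX var_imagel var_imager skew_br_VT.
- by rewrite raddf0 -[LHS](pbr_alt (V j : S)).
- by rewrite poly_mapZXX !var_imager skew_br_VV.
Qed.

(** Both [tgwp_bracket] and [gwa_map] evaluate at [gwa_repr], so this is [poly_map_bracket] at those
    representatives. *)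
Lemma gwa_map_bracket u v :
  gwa_map k R n a (tgwp_bracket d mu gamma u v) =
  br (gwa_map k R n a u) (gwa_map k R n a v).
Proof. by rewrite /tgwp_bracket gwa_mapE poly_map_bracket. Qed.

(** * The image is S' *)

Lemma gwa_map_image u : gwa_map k R n a u \in gen_subalg_pred (sprime_gen a).
Proof.
pose I := gen_subalg_pred (@sprime_gen k R n a).
have CI r : laurentC n r \in I.
  by apply/gen_subalgP/gen_subalg_gen; left; exists r.
rewrite -[u]gwa_reprK gwa_mapE; move: (gwa_repr u).
apply: mpoly_gen_ind => [_ [[r ->]|[v ->]]|f g|f g].
- by rewrite poly_mapC.
- rewrite poly_mapX.
  case: (split_ordP v) => i ->; apply/gen_subalgP/gen_subalg_gen.
    by rewrite var_imagel; right; left; exists i.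
  rewrite var_imager; right; right; exists i.
  by rewrite /laurentC /laurentTV lmonM mulr1 add0r.
- by rewrite rmorphD; exact: rpredD.
- by rewrite rmorphM; exact: rpredM.
Qed.

(** The generators are the images of r, x_i and y_i, and the image of an algebra morphism is closed
    under the operations generating S'. *)
Lemma gwa_map_surj f :
  gen_subalg (sprime_gen a) f -> exists u, f = gwa_map k R n a u.
Proof.
elim=> {f} [f|| c f g _ [u ->] _ [v ->]|f g _ [u ->] _ [v ->]].
- case=> [[r ->]|[[i ->]|[i ->]]].
  + by exists (gwaC a r); rewrite gwa_mapC.
  + by exists (gwaX a i); rewrite gwa_mapX.
  exists (gwaY a i); rewrite gwa_mapY.
  by rewrite /laurentC /laurentTV lmonM mulr1 add0r.
- by exists 1; rewrite rmorph1.
- by exists (c *: u + v); rewrite linearP.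
- by exists (u * v); rewrite rmorphM.
Qed.

Definition tgwpa_map (u : gwa a) : subalg (@sprime_gen k R n a) :=
  Subalg (gwa_map_image u).

Lemma tgwpa_map_linear : linear tgwpa_map.
Proof. by move=> c u v; apply: val_inj; exact: linearP. Qed.

Lemma tgwpa_map_monoid_morphism : monoid_morphism tgwpa_map.
Proof.
by split=> [|u v]; apply: val_inj; [exact: rmorph1|exact: rmorphM].
Qed.

HB.instance Definition _ := GRing.isLinear.Build k (gwa a)
  (subalg (@sprime_gen k R n a)) _ tgwpa_map tgwpa_map_linear.
HB.instance Definition _ := GRing.isMonoidMorphism.Build (gwa a)
  (subalg (@sprime_gen k R n a)) tgwpa_map tgwpa_map_monoid_morphism.

End PoissonMap.

Theorem theorem2p7 (k : fieldType) (n : nat) (hn : (1 <= n)%N)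
  (R : poissonAlg k) (hR : trivial_bracket R)
  (d : 'I_n -> {linear R -> R})
  (hd : forall i, poisson_derivation (d i))
  (hdc : forall (i j : 'I_n) (r : R), d i (d j r) = d j (d i r))
  (a : 'I_n -> R)
  (hareg : forall i, GRing.lreg (a i))
  (hac : forall i, poisson_central (a i))
  (mu gamma : 'I_n -> 'I_n -> k)
  (hgamma : forall i j : 'I_n, i != j -> d j (a i) = gamma i j *: a i)
  (hsum : forall i j : 'I_n, i != j ->
     gamma i j + gamma j i = mu i j + mu j i) :
  poisson_isomorphic (tgwpa hd hdc hac hgamma hsum)
                     (sprime hd hdc hac hgamma hsum).
Proof.
exists (tgwpa_map k R n a : {lrmorphism _ -> _}); split.
  have surj (x : subalg (@sprime_gen k R n a)) :
      exists u, x = tgwpa_map k R n a u.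
    have [u eu] := gwa_map_surj _ _ _ _ _
      (elimT (gen_subalgP _ _) (subalg_valP x)).
    by exists u; apply: val_inj.
  (* Choosing preimages gives a right inverse. *)
  pose g x := projT1 (boolp.cid (surj x)).
  have gK : cancel g (tgwpa_map k R n a).
    by move=> x; rewrite -(projT2 (boolp.cid (surj x))).
  (* Injectivity makes the right inverse two-sided. *)
  exists g => // u; apply: (gwa_map_inj _ _ _ _ hareg).
  by apply: (congr1 val (gK _)).
(* The bracket of S' is that of S on underlying elements. *)
by move=> u v; apply: val_inj; exact: gwa_map_bracket.
Qed.
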